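(* Let $K/\mathbb{Q}$ be an abelian number field. Then all elements of $K$ are preperiodic under iteration of the Mahler measure $M$ if and only if the maximal totally real subfield of $K$ has Galois group over $\mathbb{Q}$ isomorphic to $C_1$, $C_2$, $C_3$, or $C_2\times C_2$. In all other cases, $K$ contains a wandering algebraic unit.
   Context: $C_n$ denotes the cyclic group of order $n$. Fix an algebraic closure $\overline{\mathbb{Q}}\subseteq\mathbb{C}$ of $\mathbb{Q}$; number fields are subfields of $\overline{\mathbb{Q}}$. For $\alpha\in\overline{\mathbb{Q}}$ with (primitive) minimal polynomial $f(x)=a_nx^n+\cdots+a_0=a_n(x-\alpha_1)\cdots(x-\alpha_n)\in\mathbb{Z}[x]$ (so $f$ is irreducible in $\mathbb{Z}[x]$), the Mahler measure of $\alpha$ is $M(\alpha)=|a_n|\prod_{i=1}^n\max\{1,|\alpha_i|\}$. This is again an algebraic number, so $M$ is a map $\overline{\mathbb{Q}}\to\overline{\mathbb{Q}}$. Put $M^0(\alpha)=\alpha$ and $M^n(\alpha)=M(M^{n-1}(\alpha))$ for $n\ge1$. The point $\alpha$ is preperiodic (under iteration of $M$) if its forward orbit $\{M^n(\alpha):n\ge0\}$ is finite, and wandering if this orbit is infinite. An algebraic unit in $K$ is a unit of the ring of integers of $K$. *)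

(* Defs.v *)
From Stdlib Require Import Classical.
From HB Require Import structures.
From mathcomp Require Import all_boot all_order all_algebra.
From mathcomp Require Import all_fingroup all_solvable all_field.

Set Implicit Arguments.
Unset Strict Implicit.
Unset Printing Implicit Defensive.

Import Order.TTheory GRing.Theory Num.Theory.
Local Open Scope ring_scope.

Local Notation pQtoC := (map_poly (ratr : rat -> algC)).
Local Notation pZtoC := (map_poly (intr : int -> algC)).
Local Notation pZtoQ := (map_poly (intr : int -> rat)).

(* The primitive minimal polynomial in Z[x], with positive leading
   coefficient: minCpolyP gives the monic minimal polynomial over Q and
   rat_poly_scale clears its denominators. *)
Definition minZpoly (alpha : algC) : {poly int} :=
  zprimitive (projT1 (rat_poly_scale (sval (minCpolyP alpha)))).

Lemma minZpolyE alpha :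
  exists2 a : int, a != 0 & pZtoC (minZpoly alpha) = a%:~R *: minCpoly alpha.
Proof.
rewrite /minZpoly; case: (minCpolyP alpha) => p [Dp mon_p dv_p] /=.
case: (rat_poly_scale p) => q [a nz_a Dq] /=.
have nz_q : q != 0.
  apply: contraTneq mon_p => q0.
  by rewrite Dq q0 rmorph0 scaler0 monicE lead_coef0 eq_sym oner_eq0.
have nz_c : zcontents q != 0 by rewrite zcontents_eq0.
have Dq' : pZtoQ q = a%:~R *: p.
  by rewrite Dq scalerA divff ?intr_eq0 // scale1r.
have DC r : pZtoC r = pQtoC (pZtoQ r).
  by rewrite -map_poly_comp; apply: eq_map_poly => i /=; rewrite ratr_int.
have pq : pZtoC q = a%:~R *: minCpoly alpha.
  by rewrite DC Dq' Dp map_polyZ /= ratr_int.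
have := pq; rewrite {1}[q]zpolyEprim map_polyZ /= => prim.
have mon : lead_coef (minCpoly alpha) = 1 by apply/monicP/minCpoly_monic.
have Dl : (zcontents q)%:~R * (lead_coef (zprimitive q))%:~R = a%:~R :> algC.
  have := congr1 lead_coef prim; rewrite !lead_coefZ mon mulr1 => <-.
  by rewrite [in RHS]lead_coef_map_inj //; apply: intr_inj.
exists (lead_coef (zprimitive q)).
  by rewrite lead_coef_eq0 zprimitive_eq0.
apply: (@scalerI _ _ ((zcontents q)%:~R : algC)); first by rewrite intr_eq0.
by rewrite prim scalerA Dl.
Qed.

Lemma minZpoly_primitive alpha : zcontents (minZpoly alpha) = 1.
Proof.
have [a nz_a Da] := minZpolyE alpha.
have : minZpoly alpha != 0.
  apply: contraTneq nz_a => f0; have := congr1 lead_coef Da.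
  rewrite f0 rmorph0 lead_coef0 lead_coefZ.
  rewrite (monicP (minCpoly_monic alpha)) mulr1 => /esym/eqP.
  by rewrite intr_eq0 => ->.
rewrite /minZpoly; set q := projT1 _ => nz_q.
by rewrite zcontents_primitive -zprimitive_eq0 nz_q.
Qed.

(* Roots in algC, listed with multiplicity. *)
Definition Croots (p : {poly algC}) : seq algC :=
  sval (closed_field_poly_normal p).

Definition mahler (alpha : algC) : algC :=
  `|(lead_coef (minZpoly alpha))%:~R|
    * \prod_(z <- Croots (pZtoC (minZpoly alpha))) Num.max 1 `|z|.

Definition preperiodic (alpha : algC) : Prop :=
  exists s : seq algC, forall n : nat, iter n mahler alpha \in s.

Definition wandering (alpha : algC) : Prop := ~ preperiodic alpha.

(* A number field is an abstract finite extension K of Q, placed in algC by a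
   ring morphism iota : K -> algC given separately. *)
Definition abelian_number_field (K : splittingFieldType rat) : Prop :=
  galois 1%AS {:K}%AS /\ abelian 'Gal({:K}%AS / 1%AS).

Section TotallyReal.

Variable K : fieldExtType rat.

(* Num.real on algC is the subfield of real algebraic numbers. *)
Definition totally_real (F : {subfield K}) : Prop :=
  forall (sigma : {rmorphism subvs_of F -> algC}) (x : subvs_of F),
    sigma x \is Num.real.

Definition maximal_totally_real (F : {subfield K}) : Prop :=
  totally_real F /\ forall E : {subfield K}, totally_real E -> (E <= F)%VS.

Lemma totally_real_sub (E F : {subfield K})
    (sigma : {rmorphism subvs_of F -> algC}) (x : subvs_of F) :
  totally_real E -> (E <= F)%VS -> vsval x \in E -> sigma x \is Num.real.
Proof.
move=> trE sEF Ex.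
pose i (y : subvs_of E) : subvs_of F := vsproj F (vsval y).
have iK y : vsval (i y) = vsval y.
  by rewrite vsprojK // (subvP sEF) // subvsP.
have iB : zmod_morphism i by move=> y z; apply: val_inj; rewrite /= !iK.
have iM : monoid_morphism i.
  by split=> [|y z]; apply: val_inj; rewrite /= !iK /= ?algid1.
pose iZ := GRing.isZmodMorphism.Build (subvs_of E) (subvs_of F) i iB.
pose iMM := GRing.isMonoidMorphism.Build (subvs_of E) (subvs_of F) i iM.
pose j : {rmorphism subvs_of E -> subvs_of F} := HB.pack i iZ iMM.
have -> : x = j (vsproj E (vsval x)).
  by apply: val_inj; rewrite /= iK vsprojK.
exact: (trE (sigma \o j)).
Qed.

Lemma totally_real1 : totally_real 1%AS.
Proof.
move=> sigma x; have /vlineP[a Dx] := subvsP x.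
have -> : x = a *: 1 by apply: (@subvs_inj _ _ 1%AS); rewrite Dx /= algid1.
by rewrite rmorphZ_num rmorph1 mulr1 Creal_Crat ?Crat_rat.
Qed.

Lemma totally_realM (E F : {subfield K}) :
  totally_real E -> totally_real F -> totally_real (E * F)%AS.
Proof.
move=> trE trF sigma x.
have sE : (E <= E * F)%VS by apply: field_subvMr.
have sF : (F <= E * F)%VS by apply: field_subvMl.
have: vsval x \in (E * F)%VS by apply: subvsP.
rewrite /prodv unlock => xS; set X := (X in <<X>>%VS) in xS.
have Dx := coord_span (X := in_tuple X) xS; rewrite /= in Dx.
have memX i : X`_i = 0 \/
    exists u v : K, [/\ u \in E, v \in F & X`_i = u * v].
  have [/(mem_nth 0) | /(nth_default 0)->] := ltnP i (size X); last by left.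
  by case/allpairsP=> -[u v] /= [/vbasis_mem uE /vbasis_mem vF ->];
     right; exists u, v.
have real_sigma (y : K) : y \in E \/ y \in F ->
    sigma (vsproj (E * F)%AS y) \is Num.real.
  case=> [yE | yF].
    by apply: (totally_real_sub sigma trE sE); rewrite vsprojK //;
      apply: (subvP sE).
  by apply: (totally_real_sub sigma trF sF); rewrite vsprojK //;
      apply: (subvP sF).
rewrite -(vsvalK x) Dx linear_sum rmorph_sum rpred_sum // => i _ /=.
rewrite linearZ rmorphZ_num; apply: realM => /=.
  by rewrite Creal_Crat ?Crat_rat.
have [-> | [u [v [uE vF ->]]]] := memX i; first by rewrite linear0 rmorph0.
have -> : vsproj (E * F)%AS (u * v) =
    vsproj (E * F)%AS u * vsproj (E * F)%AS v.
  apply: val_inj; rewrite /= !vsprojK ?memv_mul //.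
    exact: (subvP sF).
  exact: (subvP sE).
by rewrite rmorphM; apply: realM; apply: real_sigma; [left | right].
Qed.

Lemma maximal_totally_real_exists :
  exists F : {subfield K}, maximal_totally_real F.
Proof.
suff H n (E : {subfield K}) : totally_real E -> (\dim {:K} - \dim E < n)%N ->
    exists F, maximal_totally_real F.
  exact: H totally_real1 (ltnSn _).
elim: n E => // n IHn E trE ltEn.
have [max_E | nmax_E] :=
  classic (forall G : {subfield K}, totally_real G -> (G <= E)%VS).
  by exists E.
have [G nG] := not_all_ex_not _ _ nmax_E.
have [trG /negP nsGE] := imply_to_and _ _ nG.
apply: (IHn (E * G)%AS); first exact: totally_realM.
have ltE : (\dim E < \dim (E * G))%N.
  rewrite ltn_neqAle dimvS ?field_subvMr // andbT.
  apply: contraNneq nsGE => eqd.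
  have /eqP -> : E == (E * G)%VS :> {vspace K}.
    by rewrite eqEdim field_subvMr eqd leqnn.
  exact: field_subvMl.
have leK : (\dim (E * G) <= \dim {:K})%N by rewrite dimvS ?subvf.
by rewrite -ltnS; apply: leq_trans ltEn; rewrite ltnS ltn_sub2l // (leq_trans ltE).
Qed.

End TotallyReal.

(* Zp n is cyclic of order n, trivial for n = 1 although 'Z_1 is Z/2. *)
Definition isog_C1_C2_C3_C2xC2 (gT : finGroupType) (G : {set gT}) : Prop :=
  [\/ G \isog Zp 1, G \isog Zp 2, G \isog Zp 3
    | G \isog setX (Zp 2) (Zp 2)].

(* The ring of integers of K is the preimage of Aint under iota. *)
Definition algebraic_unit (K : fieldExtType rat)
    (iota : {rmorphism K -> algC}) (u : K) : Prop :=
  iota u \in Aint /\ exists2 v : K, iota v \in Aint & u * v = 1.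

(* Main.v *)
From Stdlib Require Import Classical.
Require Import Defs.
From HB Require Import structures.
From mathcomp Require Import all_boot all_order all_algebra.
From mathcomp Require Import all_fingroup all_solvable all_field.
From mathcomp Require Import ring lra zify.
(** The maximal totally real subfield F of K consists of the x with [iota x] real,
    and H = Gal(F/Q) is abelian.  For every x in K the Mahler measure is, up to sign,
    the leading coefficient times the product of the conjugates outside the unit
    circle; this product is fixed by complex conjugation, so M(x) is an integer of F.

    If H is in the list, the orbit of an integer x of F stays among the numbers
    +-m N_S(x), where m >= 1 is an integer and N_S(x) is the product of the g x with
    g in S, S a subset of H: the product of distinct translates of N_S(x) is again of
    this form when S or its complement has at most one element, and when |H| = 4, H
    has exponent 2 and |S| = 2.  Once m is large all the conjugates exceed 1, so the
    next term is an integer.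

    Otherwise H has a direct factor C_n (n >= 4), C_3 x C_3 or C_2 x C_2 x C_2.  A
    pigeonhole argument gives a unit u of F with |g u| < 1 for all g <> 1, and taking
    norms moves it to the subfields attached to the factors.
    - C_n: let w be a unit whose conjugates t^i w of absolute value > 1 form an arc of
      length between 2 and n - 2 on the cycle Z/n.  Then M(w) has the same property
      (the logarithms of its conjugates are window sums of those of w; a zero sum would
      give a real unit of absolute value 1, that is +-1), and M(w) > |w|.
    - C_3 x C_3: let w = y z with y, z suitable powers of units of the two cubic
      subfields, such that |s^i t^j w| > 1 exactly when i = 0 or j = 0.  The product
      over this cross is w^2 up to sign, so |M^k(w)| = |w|^(2^k).
    - C_2 x C_2 x C_2: the same with three quadratic units and the majority rule. *)

Set Implicit Arguments.
Unset Strict Implicit.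
Unset Printing Implicit Defensive.
Import Order.TTheory GRing.Theory Num.Theory.
Local Open Scope ring_scope.

(** * Mahler measures of algebraic integers *)

Local Notation pQtoC := (map_poly (ratr : rat -> algC)).
Local Notation pZtoC := (map_poly (intr : int -> algC)).

(** [Croots] is an unspecified root list; two splittings of one polynomial into linear factors
    differ by a permutation, so any list [r] computes M. *)
Lemma mahlerE alpha (r : seq algC) :
    minCpoly alpha = \prod_(z <- r) ('X - z%:P) ->
  mahler alpha = `|(lead_coef (minZpoly alpha))%:~R|
                 * \prod_(z <- r) Num.max 1 `|z|.
Proof.
move=> Dr; rewrite /mahler; congr (_ * _); apply: perm_big.
apply: prod_XsubC_eq; rewrite -Dr /Croots.
case: (closed_field_poly_normal _) => s /= Ds.
have [a nz_a Da] := minZpolyE alpha.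
have la : lead_coef (pZtoC (minZpoly alpha)) = a%:~R.
  by rewrite Da lead_coefZ (monicP (minCpoly_monic alpha)) mulr1.
have nz_aC : a%:~R != 0 :> algC by rewrite intr_eq0.
by apply: (scalerI nz_aC); rewrite -{1}la -Ds Da.
Qed.

Lemma lead_minZpoly alpha :
  pZtoC (minZpoly alpha) = (lead_coef (minZpoly alpha))%:~R *: minCpoly alpha.
Proof.
have [a nz_a Da] := minZpolyE alpha; rewrite Da; congr (_ *: _).
have := congr1 lead_coef Da; rewrite lead_coefZ.
rewrite (monicP (minCpoly_monic alpha)) mulr1 => <-.
by rewrite lead_coef_map_inj //; apply: intr_inj.
Qed.

Lemma lead_minZpoly_neq0 alpha : lead_coef (minZpoly alpha) != 0.
Proof.
have [a nz_a Da] := minZpolyE alpha; rewrite lead_coef_eq0.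
apply: contraTneq nz_a => f0; have := congr1 lead_coef Da.
rewrite f0 rmorph0 lead_coef0 lead_coefZ.
by rewrite (monicP (minCpoly_monic alpha)) mulr1 => /esym/eqP; rewrite intr_eq0 => ->.
Qed.

Lemma Aint_minCpoly alpha : alpha \in Aint ->
  exists q : {poly int}, minCpoly alpha = pZtoC q.
Proof. by rewrite unfold_in => /floorpP[q ->]; exists q. Qed.

(** The primitive polynomial [minZpoly alpha] is an integer multiple of the integral polynomial [q],
    so the multiplier divides the content, which is 1. *)
Lemma lead_minZpoly_Aint alpha : alpha \in Aint ->
  `|(lead_coef (minZpoly alpha))%:~R| = 1 :> algC.
Proof.
case/Aint_minCpoly=> q Dq; have := lead_minZpoly alpha; rewrite Dq.
set a := lead_coef _ => /esym Da.
have {}Da : a *: q = minZpoly alpha.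
  by apply: (map_inj_poly (@intr_inj algC)) => //; rewrite -Da map_polyZ.
have := congr1 zcontents Da; rewrite minZpoly_primitive zcontentsZ => E.
have /eqP: (`|a| * `|zcontents q| = 1)%N by rewrite -abszM E.
by rewrite muln_eq1 => /andP[/eqP a1 _]; rewrite -intr_norm -abszE a1.
Qed.

Lemma mahler_Aint alpha (r : seq algC) : alpha \in Aint ->
    minCpoly alpha = \prod_(z <- r) ('X - z%:P) ->
  mahler alpha = \prod_(z <- r) Num.max 1 `|z|.
Proof. by move=> Za /mahlerE->; rewrite lead_minZpoly_Aint // mul1r. Qed.

Lemma prod_max1 (r : seq algC) :
  \prod_(z <- r) Num.max 1 `|z| = `|\prod_(z <- r | 1 < `|z|) z|.
Proof.
rewrite normr_prod [RHS]big_mkcond; apply: eq_bigr => z _ /=.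
by rewrite maxElt.
Qed.

Lemma map_intr_monic (q : {poly int}) : (pZtoC q \is monic) = (q \is monic).
Proof.
rewrite !monicE lead_coef_map_inj ?rmorph0 //; last exact: intr_inj.
by rewrite -(inj_eq (@intr_inj algC)).
Qed.

(** Transitivity of integrality: every coefficient is a root of its own monic integer polynomial. *)
Lemma Aint_root_monic (p : {poly algC}) x :
  p \is monic -> root p x -> p \is a polyOver Aint -> x \in Aint.
Proof.
move=> mon_p px0 /polyOverP Zp.
have [|q mon_q qx0] := @integral_root_monic int algC intr x p mon_p px0.
  move=> z /(nthP 0)[i _ <-].
  have [q Dq] := Aint_minCpoly (Zp i); exists q; last by rewrite -Dq root_minCpoly.
  by rewrite -map_intr_monic -Dq minCpoly_monic.
apply: (root_monic_Aint qx0); first by rewrite map_intr_monic.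
by apply/polyOverP => i; rewrite coef_map /= intr_int.
Qed.

Lemma lead_coef_mul_root (p : {poly algC}) x :
  p \is a polyOver Aint -> root p x -> lead_coef p * x \in Aint.
Proof.
move=> Zp px0; have [-> | nz_p] := eqVneq p 0; first by rewrite lead_coef0 mul0r Aint0.
set n := (size p).-1; have Dn : size p = n.+1.
  by rewrite prednK // lt0n size_poly_eq0.
set b := lead_coef p.
(* b^(n-1) p(X/b) made monic: X^n + sum_(i<n) p_i b^(n-1-i) X^i *)
pose r : {poly algC} := \poly_(i < n) (p`_i * b ^+ (n.-1 - i)).
pose q : {poly algC} := 'X^n + r.
have sq : (size r < size ('X^n : {poly algC}))%N.
  by rewrite size_polyXn ltnS size_poly.
apply: (@Aint_root_monic q).
- by rewrite monicE lead_coefDl // lead_coefXn.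
- case: n Dn @r @q sq => [|m] Dn r q sq.
    by have := root_size_gt1 nz_p px0; rewrite Dn.
  rewrite /q /= rootE hornerD hornerXn horner_poly exprMn.
  move: px0; rewrite rootE horner_coef Dn big_ord_recr /=.
  move/eqP/(congr1 (fun y => b ^+ m * y)).
  have -> : p`_m.+1 = b by rewrite /b lead_coefE Dn.
  rewrite mulr0 mulrDr mulrA -exprSr addrC mulr_sumr => E.
  apply/eqP; rewrite -[RHS]E; congr (_ + _); apply: eq_bigr => i _.
  have -> : b ^+ m = b ^+ (m - i) * b ^+ i by rewrite -exprD subnK // -ltnS.
  by rewrite exprMn; ring.
apply: rpredD; first by apply: rpredX; rewrite polyOverX.
apply/polyOverP=> i; rewrite coef_poly; case: ifP => _; last by rewrite Aint0.
by rewrite rpredM ?rpredX ?(polyOverP Zp) // lead_coefE (polyOverP Zp).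
Qed.

(** Induction on the degree. Dropping the leading term [b X^m] of [p] changes the product by terms
    with coefficients [b] and [b * x]; the latter is integral by [lead_coef_mul_root], as [x] is a
    root of the product. *)
Lemma Aint_polyOver_divXsubC (p : {poly algC}) x :
  ('X - x%:P) * p \is a polyOver Aint -> p \is a polyOver Aint.
Proof.
have [n] := ubnP (size p); elim: n p => // n IHn p; rewrite ltnS => le_p_n Zq.
have [-> | nz_p] := eqVneq p 0; first exact: rpred0.
set m := (size p).-1; have Dm : size p = m.+1.
  by rewrite prednK // lt0n size_poly_eq0.
set b := lead_coef p; set q := ('X - x%:P) * p in Zq *.
have lq : lead_coef q = b by rewrite /q lead_coefM lead_coefXsubC mul1r.
have Zbx : b * x \in Aint.
  by rewrite -lq; apply: lead_coef_mul_root; rewrite ?rootM ?root_XsubC ?eqxx.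
have Zb : b \in Aint by rewrite -lq lead_coefE (polyOverP Zq).
pose p1 : {poly algC} := \poly_(i < m) p`_i.
have Dp : p = p1 + b *: 'X^m.
  apply/polyP=> i; rewrite coefD coef_poly coefZ coefXn.
  case: ltngtP => [lt_im|lt_mi|->]; rewrite ?mulr0 ?mulr1 ?addr0 ?add0r //.
  by rewrite nth_default // Dm.
rewrite Dp rpredD ?polyOverZ ?rpredX ?polyOverX //.
apply: IHn; first by rewrite (leq_ltn_trans (size_poly _ _)) // -Dm.
have -> : ('X - x%:P) * p1 = q - b *: 'X^(m.+1) + (b * x) *: 'X^m.
  by rewrite /q Dp -!mul_polyC polyCM exprS; ring.
by rewrite rpredD ?rpredB ?polyOverZ ?rpredX ?polyOverX.
Qed.

(** Divide out the linear factors of the roots outside [P], keeping integrality; the constant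
    coefficient of what remains is the required product up to sign. *)
Lemma Aint_lead_prod_roots (a : algC) (r : seq algC) (P : pred algC) :
    a *: \prod_(z <- r) ('X - z%:P) \is a polyOver Aint ->
  a * \prod_(z <- r | P z) z \in Aint.
Proof.
move=> Zr; have {Zr} : a *: \prod_(z <- r | P z) ('X - z%:P) \is a polyOver Aint.
  move: Zr; rewrite (bigID P) /= mulrC.
  elim: r (\prod_(z <- r | P z) _) => [|x r IHr] p.
    by rewrite big_nil mul1r.
  rewrite big_cons; case: (P x) => //=; first exact: IHr.
  rewrite -mulrA scalerAr => /Aint_polyOver_divXsubC; exact: IHr.
move/polyOverP/(_ 0%N); rewrite coefZ -horner_coef0 horner_prod.
under eq_bigr do rewrite hornerXsubC sub0r -mulN1r.
rewrite big_split /=; set e := \prod_(z <- r | P z) -1 => Ze.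
have e2 : e * e = 1 by rewrite -big_split /= big1 // => z _; rewrite mulrNN mulr1.
set T := \prod_(z <- r | P z) z in Ze *.
have -> : a * T = e * (a * (e * T)) by rewrite [RHS]mulrCA [e * (e * T)]mulrA e2 mul1r.
apply: rpredM; last exact: Ze.
by apply: rpred_prod => z _; rewrite rpredN Aint1.
Qed.

(** Complex conjugation permutes the selected roots. *)
Lemma prod_roots_real (r : seq algC) (P : pred algC) :
    uniq r -> (forall z, z \in r -> z^* \in r) -> (forall z, P z^* = P z) ->
  \prod_(z <- r | P z) z \is Num.real.
Proof.
move=> Ur cr cP; apply/CrealP; rewrite rmorph_prod /=.
under eq_bigl do rewrite -cP.
rewrite -(big_map Num.conj P id) /=; apply: perm_big.
have Uc : uniq (map Num.conj r) by rewrite map_inj_uniq //; apply: (can_inj conjCK).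
apply: uniq_perm => // z; apply/mapP/idP=> [[y ry ->] | rz]; first exact: cr.
by exists z^*; rewrite ?conjCK ?cr.
Qed.

(** * Conjugates of an element of a Galois subfield *)

Section Conjugates.

Variables (K : splittingFieldType rat) (iota : {rmorphism K -> algC}).

Local Notation pQtoK := (map_poly (in_alg K)).

Lemma iota_ratr_poly (q : {poly rat}) : map_poly iota (pQtoK q) = pQtoC q.
Proof.
by rewrite -map_poly_comp; apply: eq_map_poly => a; rewrite /= rmorphZ_num rmorph1 mulr1.
Qed.

Lemma minCpoly_iota x : minCpoly (iota x) = map_poly iota (minPoly 1 x).
Proof.
have [q [Dq mon_q] dv_q] := minCpolyP (iota x).
have [p Dp] := polyOver1P (minPolyOver 1 x).
rewrite Dq -iota_ratr_poly; congr map_poly; apply/eqP.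
rewrite -eqp_monic ?map_monic ?monic_minPoly //.
apply/andP; split; last first.
  apply: minPoly_dvdp; first by apply/polyOver1P; exists q.
  by rewrite -(fmorph_root iota) iota_ratr_poly dv_q dvdpp.
rewrite Dp dvdp_map -dv_q -iota_ratr_poly fmorph_root -Dp.
exact: root_minPoly.
Qed.

Variable E : {subfield K}.
Hypothesis galE : galois 1 E.

Local Notation G := ('Gal(E / 1%AS)%g).

(** The duplicate-free list [R] of the orbit is left free: later it is indexed by a cycle, a grid or
    a list of automorphisms. *)
Lemma minCpoly_conjugates (x : K) (R : seq K) :
    x \in E -> uniq R -> R =i [seq g x | g : gal_of E in G] ->
  minCpoly (iota x) = \prod_(z <- map iota R) ('X - z%:P).
Proof.
move=> Ex UR DR; have [r [sr Ur Dr]] := galois_factors (sub1v E) galE x Ex.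
rewrite minCpoly_iota Dr rmorph_prod [RHS]big_map /=.
under eq_bigr do rewrite map_polyXsubC.
apply: perm_big; apply: uniq_perm => // y.
rewrite DR -root_prod_XsubC -Dr; apply/idP/imageP => [p0 | [g Gg ->]].
  have nE : normalField 1 E by case/and3P: galE.
  by have [g Gg <-] := normalField_root_minPoly (sub1v E) nE Ex p0; exists g.
by apply: root_minPoly_gal; rewrite ?sub1v.
Qed.

End Conjugates.

(** * The maximal totally real subfield *)

Lemma conj_ratr_poly (q : {poly rat}) x : (pQtoC q).[x]^* = (pQtoC q).[x^*].
Proof.
rewrite -horner_map -map_poly_comp; congr _.[_].
by apply: eq_map_poly => a /=; rewrite conj_Crat ?Crat_rat.
Qed.

Lemma conj_root_minCpoly x y :
  root (minCpoly x) y -> root (minCpoly x) y^*.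
Proof.
have [q [-> _] _] := minCpolyP x; rewrite !rootE -conj_ratr_poly => /eqP->.
by rewrite rmorph0.
Qed.

Section RealSubfield.

Variables (K : splittingFieldType rat) (iota : {rmorphism K -> algC}).
Hypothesis abK : abelian_number_field K.

Local Notation pQtoK := (map_poly (in_alg K)).
Local Notation GK := ('Gal({:K} / 1%AS)%g).

Lemma root_pQtoC_conj (x : K) (y : algC) :
  root (minCpoly (iota x)) y -> exists2 g, g \in GK & y = iota (g x).
Proof.
have [galK _] := abK; set R := undup [seq g x | g : gal_of {:K} in GK].
have DR : R =i [seq g x | g : gal_of {:K} in GK] by apply: mem_undup.
rewrite (@minCpoly_conjugates _ iota _ galK x R) ?memvf ?undup_uniq //.
by rewrite root_prod_XsubC => /mapP[z]; rewrite DR => /imageP[g Gg ->] ->; exists g.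
Qed.

Lemma gal_ratr_poly (g : gal_of {:K}) (q : {poly rat}) x :
  g (pQtoK q).[x] = (pQtoK q).[g x].
Proof.
rewrite -(horner_map g) -map_poly_comp; congr _.[_].
by apply: eq_map_poly => a; rewrite /= rmorph_alg.
Qed.

(** For a primitive element [t], the conjugate of [iota t] is another root of its minimal
    polynomial, hence some [iota (c t)]; the two maps then agree on all polynomials in [t], that is
    on K. *)
Lemma complex_conj_gal :
  exists2 c, c \in GK & forall x : K, iota (c x) = (iota x)^*.
Proof.
have [galK _] := abK; have /and3P[_ sepK _] := galK.
have Dt := eq_adjoin_separable_generator sepK (sub1v _).
set t := separable_generator _ _ in Dt.
have [c Gc Dc] : exists2 c, c \in GK & (iota t)^* = iota (c t).
  by apply: root_pQtoC_conj; rewrite conj_root_minCpoly ?root_minCpoly.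
exists c => // x; have: x \in <<1; t>>%VS by rewrite -Dt memvf.
case/Fadjoin_polyP => p /polyOver1P[q ->] ->.
by rewrite gal_ratr_poly -!(horner_map iota) !iota_ratr_poly /= -Dc conj_ratr_poly.
Qed.

(** An automorphism depending on [y] suffices below; it exists because [sigma y] is a root of the
    minimal polynomial of [y]. *)
Lemma subfield_morph_gal (E : {subfield K}) (sigma : {rmorphism subvs_of E -> algC})
    (y : subvs_of E) :
  exists2 g, g \in GK & sigma y = iota (g (vsval y)).
Proof.
apply: root_pQtoC_conj; have [q [Dq _] _] := minCpolyP (iota (vsval y)).
have: root (minCpoly (iota (vsval y))) (iota (vsval y)) by apply: root_minCpoly.
rewrite Dq -{1}(iota_ratr_poly iota) fmorph_root.
have -> : pQtoK q = map_poly vsval (map_poly (in_alg (subvs_of E)) q).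
  by rewrite -map_poly_comp; apply: eq_map_poly => a; rewrite /= algid1.
rewrite fmorph_root -(fmorph_root sigma) -map_poly_comp.
suff /eq_map_poly-> : sigma \o in_alg (subvs_of E) =1 ratr by [].
by move=> a; rewrite /= rmorphZ_num rmorph1 mulr1.
Qed.

Lemma galois_subfield (F : {subfield K}) : galois 1 F.
Proof.
have [galK cGG] := abK.
have galF : galois F {:K}.
  by apply: galoisS galK; rewrite sub1v subvf.
rewrite -(galois_fixedField galF).
apply: normal_fixedField_galois => //.
by rewrite -sub_abelian_normal // galS ?sub1v.
Qed.

Lemma abelian_Gal_subfield (F : {subfield K}) : abelian 'Gal(F / 1%AS)%g.
Proof.
have [galK cGG] := abK; have /and3P[_ _ nF] := galois_subfield F.
have sF : (1 <= F <= {:K})%VS by rewrite sub1v subvf.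
by rewrite -(normalField_img galK sF nF) morphim_abelian.
Qed.

Variable F : {subfield K}.
Hypothesis maxF : maximal_totally_real F.

Lemma mem_maximal_totally_real x : (x \in F) = (iota x \is Num.real).
Proof.
have [trF maxF'] := maxF; apply/idP/idP=> [Fx | Rx].
  by have := trF (iota \o vsval) (vsproj F x); rewrite /= vsprojK.
have [c Gc Dc] := complex_conj_gal.
(* The field fixed by complex conjugation [c] is totally real: [c] commutes with every [g], so
   [iota (g y)] is real too. By maximality it lies in F. *)
have /subvP: (fixedField [set c] <= F)%VS.
  apply: (maxF' [aspace of fixedField [set c]]) => sigma y.
  have [g Gg ->] := subfield_morph_gal sigma y.
  have /mem_fixedFieldP[_ cy] := subvsP y.
  apply/CrealP; rewrite -Dc -galM ?memvf //.
  have [_ /centsP cGG] := abK; rewrite (cGG g Gg c Gc) galM ?memvf //.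
  by rewrite cy ?set11.
apply; apply/fixedFieldP; first exact: memvf.
move=> _ /set1P->; apply: (fmorph_inj iota); rewrite Dc; exact/CrealP.
Qed.

End RealSubfield.

(** * Arcs of a cycle and window products *)

Section CyclicWindows.

Variables (R : realFieldType) (n p : nat) (L : nat -> R).
Hypotheses (perL : forall i, L (i + n)%N = L i) (posL : forall i, 0 < L i).
Hypothesis normL : \prod_(i < n) L i = 1.
Hypotheses (p_gt1 : (1 < p)%N) (p_lt : (p.+2 <= n)%N).
Hypothesis highL : forall i, (i < p)%N -> 1 < L i.
Hypothesis lowL : forall i, (p <= i < n)%N -> L i < 1.

(** In the application the [L i] are the absolute values of the conjugates of a unit along a cycle,
    and [W j] is that of the j-th conjugate of its Mahler measure. *)
Let W j := \prod_(i < p) L (j + i)%N.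

Hypothesis W_neq1 : forall j, W j != 1.

Lemma prod_gt1 m (f : 'I_m -> R) : (0 < m)%N -> (forall i, 1 < f i) ->
  1 < \prod_i f i.
Proof.
case: m f => // m f _ f1; rewrite big_ord_recl.
have : 1 <= \prod_(i < m) f (lift ord0 i).
  by elim/big_ind: _ => // [x y x1 y1|i _]; [nra | exact/ltW].
by have := f1 ord0; nra.
Qed.

Lemma prod_lt1 m (f : 'I_m -> R) : (0 < m)%N -> (forall i, 0 < f i < 1) ->
  \prod_i f i < 1.
Proof.
move=> m_gt0 f1; have f0 i : 0 < f i by case/andP: (f1 i).
rewrite -invf_gt1 ?prodr_gt0 // -prodfV; apply: prod_gt1 => // i.
by rewrite invf_gt1 //; case/andP: (f1 i).
Qed.

Let Wpos j : 0 < W j. Proof. by apply: prodr_gt0. Qed.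

Let WS j : W j.+1 * L j = W j * L (j + p)%N.
Proof.
rewrite /W; have -> : \prod_(i < p) L (j.+1 + i)%N * L j = \prod_(i < p.+1) L (j + i)%N.
  rewrite big_ord_recl /= addn0 mulrC; congr (_ * _).
  by apply: eq_bigr => i _; congr L; rewrite /bump leq0n; lia.
by rewrite big_ord_recr.
Qed.

Let full j : \prod_(i < n) L (j + i)%N = 1.
Proof.
elim: j => [|j IH]; first by rewrite -[RHS]normL.
apply: (mulIf (lt0r_neq0 (posL j))); rewrite mul1r.
have: \prod_(i < n.+1) L (j + i)%N = L j by rewrite big_ord_recr /= IH mul1r perL.
rewrite big_ord_recl /= addn0 => {2}<-; rewrite mulrC; congr (_ * _).
by apply: eq_bigr => i _; congr L; rewrite /bump leq0n; lia.
Qed.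

Let Wn j : W (j + n)%N = W j.
Proof. by apply: eq_bigr => i _; rewrite addnAC perL. Qed.

Let compl j : W j * \prod_(i < n - p) L (j + p + i)%N = 1.
Proof.
have -> : \prod_(i < n - p) L (j + p + i)%N = \prod_(p <= i < n) L (j + i)%N.
  rewrite -[p in RHS]add0n big_addn big_mkord.
  by apply: eq_bigr => i _; congr L; lia.
rewrite -[RHS](full j) -[RHS](big_mkord xpredT (fun i => L (j + i)%N)).
by rewrite [RHS](big_cat_nat _ (n := p)) ?big_mkord //=; lia.
Qed.

(** Sliding the window drops a factor above 1 and gains one below 1. *)
Let W_dec j : (j < p)%N -> (j < n - p)%N -> W j.+1 < W j.
Proof.
move=> lt_jp lt_jq; have := WS j.
have := highL lt_jp; have : L (j + p)%N < 1 by apply: lowL; lia.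
have := Wpos j; have := Wpos j.+1; have := posL (j + p)%N; nra.
Qed.

(** The right end has passed n: the window drops a factor below 1 and gains [L (j + p - n)], which
    lies in the high arc. *)
Let W_inc j : (p <= j < n)%N -> (n - p <= j)%N -> W j < W j.+1.
Proof.
move=> le_pj le_qj; have := WS j.
have := lowL le_pj; have : 1 < L (j + p)%N.
  have -> : (j + p = (j + p - n) + n)%N by lia.
  by rewrite perL; apply: highL; lia.
have := Wpos j; have := Wpos j.+1; have := posL j; nra.
Qed.

(** If p <= n - p the window lies inside the low arc; otherwise its complement, read modulo n, lies
    inside the high arc, and the total product is 1. *)
Let W_low j : (minn p (n - p) <= j <= maxn p (n - p))%N -> W j < 1.
Proof.
move=> Hj; case: (leqP p (n - p)) => le_pq.
  apply: prod_lt1 => [|i]; first by lia.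
  by rewrite posL lowL //; have := ltn_ord i; lia.
have := compl j; set c := \prod_(i < _) _.
have c1 : 1 < c.
  apply: prod_gt1 => [|i]; first by lia.
  have -> : (j + p + i = (j + p + i - n) + n)%N by have := ltn_ord i; lia.
  by rewrite perL; apply: highL; have := ltn_ord i; lia.
have := Wpos j; nra.
Qed.

Let W0_gt1 : 1 < W 0.
Proof. by apply: prod_gt1 => [|i]; [lia | apply: highL; have := ltn_ord i; lia]. Qed.

(** Keeps the new arc from shrinking to the index 0 alone. [W 1 * W n.-1] equals [W 0 ^ 2 * (L p * L
    n.-1) / (L 0 * L p.-1)], which is at least 1 because [L 0 * L p.-1 <= W 0] and
    [1 <= W 0 * (L p * L n.-1)]; both hold since each arc has two distinct ends. *)
Let W_nbr : (1 < W 1) || (1 < W n.-1).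
Proof.
suff: 1 <= W 1 * W n.-1.
  move=> W1n; rewrite -[_ || _]negbK negb_or -!real_leNgt ?num_real //.
  apply/negP=> /andP[]; have := Wpos 1; have := Wpos n.-1.
  have := W_neq1 1; have := W_neq1 n.-1; rewrite !neq_lt; nra.
have W1 := WS 0; have := WS n.-1; rewrite prednK; last by lia.
have -> : W n = W 0 by rewrite -[n]add0n Wn.
have -> : L (n.-1 + p)%N = L p.-1 by rewrite -(perL p.-1); congr L; lia.
rewrite add0n in W1 => Wm.
have high : L 0 * L p.-1 <= W 0.
  rewrite /W; case: p p_gt1 highL => [|[|m]] // _ high.
  rewrite big_ord_recl big_ord_recr /= mulrCA ler_peMl ?mulr_ge0 ?(ltW (posL _)) //.
  elim/big_ind: _ => // [x y x1 y1|i _]; first by nra.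
  by apply/ltW/high; have := ltn_ord i; rewrite /bump; lia.
have low : 1 <= W 0 * (L p * L n.-1).
  rewrite -[leLHS](compl 0) ler_pM2l ?Wpos //.
  have -> : (n - p = (n - p - 2).+2)%N by lia.
  rewrite big_ord_recl big_ord_recr /= mulrCA addn0 add0n.
  have -> : (p + bump 0 (n - p - 2) = n.-1)%N by rewrite /bump; lia.
  rewrite ler_piMl ?mulr_ge0 ?(ltW (posL _)) //.
  set c := \prod_(i < _) _; suff /andP[] : 0 <= c <= 1 by [].
  rewrite /c; elim/big_ind: _ => [|x y /andP[x0 x1] /andP[y0 y1]|i _].
  - by rewrite ler01 lexx.
  - by rewrite mulr_ge0 //=; nra.
  by rewrite !ltW ?lowL //; have := ltn_ord i; rewrite /bump; lia.
have L0 := posL 0; have Lp := posL p.-1; have P1 := Wpos 1; have Pm := Wpos n.-1.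
have P0 := Wpos 0.
rewrite -(ler_pM2r (mulr_gt0 L0 Lp)) mul1r.
have -> : W 1 * W n.-1 * (L 0 * L p.-1) = W 0 * (W 0 * (L p * L n.-1)).
  by rewrite -mulrACA W1 -Wm; ring.
by apply: le_trans high _; rewrite ler_peMr // ltW.
Qed.

Theorem window_arc : exists k p', [/\ (1 < p')%N, (p'.+2 <= n)%N &
  forall i, (i < n)%N -> (1 < W (k + i)%N) = (i < p')%N].
Proof.
have Wle j : (W j <= 1) = ~~ (1 < W j) by rewrite leNgt.
have lt_min : (minn p (n - p) < n)%N by lia.
have low_mid : exists j, W j <= 1.
  by exists (minn p (n - p)); apply/ltW/W_low; lia.
(* [s] and [t] are the first and the last index below n with W <= 1; the new high arc runs from t +
   1 around the cycle to s - 1. *)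
case: (ex_minnP low_mid) => s Ws min_s.
have le_s : (s <= minn p (n - p))%N by apply: min_s; apply/ltW/W_low; lia.
have s_gt0 : (0 < s)%N by case: s Ws {min_s le_s}; rewrite // Wle W0_gt1.
have low_max : exists j, (j < n)%N && (W j <= 1).
  by exists (maxn p (n - p)); apply/andP; split; [lia | apply/ltW/W_low; lia].
have bd j : (j < n)%N && (W j <= 1) -> (j <= n)%N by case/andP=> /ltnW.
case: (ex_maxnP low_max bd) => t /andP[lt_tn Wt] max_t.
have ge_t : (maxn p (n - p) <= t)%N.
  by apply: max_t; apply/andP; split; [lia | apply/ltW/W_low; lia].
have below j : (j < s)%N -> 1 < W j.
  by move=> lt_js; rewrite ltNge; apply/negP=> /min_s; lia.
have above j : (t < j < n)%N -> 1 < W j.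
  by move=> lt_tj; rewrite ltNge; apply/negP=> Wj; have := max_t j; rewrite Wj; lia.
(* W <= 1 propagates forward from [s] while windows decrease, and backward from [t] over the range
   where they increase; [W_low] covers the middle. *)
have down d : (s + d <= minn p (n - p))%N -> W (s + d)%N <= 1.
  elim: d => [|d IHd] Hd; first by rewrite addn0.
  rewrite addnS; have := @W_dec (s + d)%N; have := IHd.
  move=> /(_ ltac:(lia)) W1 /(_ ltac:(lia) ltac:(lia)) W2; exact: le_trans (ltW W2) W1.
have up d : (maxn p (n - p) + d <= t)%N -> W (t - d)%N <= 1.
  elim: d => [|d IHd] Hd; first by rewrite subn0.
  have := @W_inc (t - d.+1)%N; have := IHd.
  have -> : ((t - d.+1).+1 = t - d)%N by lia.
  move=> /(_ ltac:(lia)) W1 /(_ ltac:(lia) ltac:(lia)) W2; exact: le_trans (ltW W2) W1.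
have mid j : (s <= j <= t)%N -> W j <= 1.
  case/andP=> le_sj le_jt; case: (leqP j (minn p (n - p))) => Hmin.
    by have -> : (j = s + (j - s))%N by [lia]; apply: down; lia.
  case: (leqP (maxn p (n - p)) j) => Hmax.
    by have -> : (j = t - (t - j))%N by [lia]; apply: up; lia.
  by apply/ltW/W_low; lia.
(* If s = t, then s = t = p and n = 2p, so the windows at 1 and p + 1 are complementary and both
   exceed 1, against product 1. Hence at least two low indices remain. *)
have st : (s < t)%N.
  rewrite ltnNge; apply/negP=> le_ts.
  have sp : s = p by lia.
  have n2p : n = (p + p)%N by lia.
  have := compl 1; have -> : \prod_(i < n - p) L (1 + p + i)%N = W p.+1.
    by have -> : (n - p = p)%N by lia.
  have := below 1%N; have := above p.+1; rewrite sp.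
  move=> /(_ ltac:(lia)) W1 /(_ ltac:(lia)) W2; nra.
exists t.+1, (n.-1 - t + s)%N; split.
- case/orP: W_nbr => W1.
    have : s != 1%N by apply: contraTneq W1 => <-; rewrite -leNgt.
    by lia.
  have : t != n.-1 by apply: contraTneq W1 => <-; rewrite -leNgt.
  by lia.
- by lia.
move=> i lt_in; case: (leqP n (t.+1 + i)) => Hi; last first.
  by rewrite above; lia.
have -> : (t.+1 + i = (t.+1 + i - n) + n)%N by lia.
rewrite Wn; case: (ltnP (t.+1 + i - n) s) => Hs.
  by rewrite below //; lia.
by rewrite ltNge mid /=; lia.
Qed.
End CyclicWindows.

(** * Real units *)

(** Strictly growing absolute values make the orbit injective, so no finite list contains it. *)
Lemma wandering_of_increasing (Q : algC -> Prop) alpha : Q alpha ->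
    (forall b, Q b -> Q (mahler b) /\ `|b| < `|mahler b|) -> wandering alpha.
Proof.
move=> Qa QM [s in_s]; pose f n := iter n mahler alpha.
have Qf n : Q (f n) by elim: n => // n /QM[].
have fS n : `|f n| < `|f n.+1| by case: (QM _ (Qf n)).
have f_inc m n : (m < n)%N -> `|f m| < `|f n|.
  elim: n => // n IHn; rewrite ltnS leq_eqVlt => /orP[/eqP-> // | /IHn lt_mn].
  exact: lt_trans (fS n).
have f_inj : injective f.
  by move=> m n eq_mn; case: (ltngtP m n) => // /f_inc; rewrite eq_mn ltxx.
have: (size (map f (iota 0 (size s).+1)) <= size s)%N.
  apply: uniq_leq_size; first by rewrite map_inj_uniq ?iota_uniq.
  by move=> _ /mapP[n _ ->]; apply: in_s.
by rewrite size_map size_iota ltnn.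
Qed.

Section RealUnits.

Variables (K : splittingFieldType rat) (iota : {rmorphism K -> algC}).
Hypothesis abK : abelian_number_field K.
Variable F : {subfield K}.
Hypothesis maxF : maximal_totally_real F.

Local Notation G := ('Gal(F / 1%AS)%g).

(** Valued in [algR] because [algC] is only partially ordered; the window, pigeonhole and balancing
    arguments need an archimedean ordered field. *)
Definition absK (x : K) : algR := in_algR (normr_real (iota x)).

Let galF : galois 1 F := galois_subfield abK F.
Let abG : abelian G := abelian_Gal_subfield abK F.

Lemma absK_val x : algRval (absK x) = `|iota x|. Proof. by []. Qed.

Lemma absKM x y : absK (x * y) = absK x * absK y.
Proof. by apply: val_inj; rewrite /= rmorphM normrM. Qed.

Lemma absKN x : absK (- x) = absK x.
Proof. by apply: val_inj; rewrite /= rmorphN normrN. Qed.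

Lemma absK1 : absK 1 = 1.
Proof. by apply: val_inj; rewrite /= rmorph1 normr1. Qed.

Lemma absKX x n : absK (x ^+ n) = absK x ^+ n.
Proof. by elim: n => [|n IHn]; rewrite ?expr0 ?absK1 // !exprS absKM IHn. Qed.

Lemma absK_prod (I : Type) (r : seq I) (P : pred I) (f : I -> K) :
  absK (\prod_(i <- r | P i) f i) = \prod_(i <- r | P i) absK (f i).
Proof. exact: (big_morph _ absKM absK1). Qed.

Lemma absK_gt0 x : x != 0 -> 0 < absK x.
Proof. by move=> nz_x; change (0 < `|iota x|); rewrite normr_gt0 fmorph_eq0. Qed.

(** F is real under [iota], so the absolute value taken by M does not leave F. *)
Lemma absK_sign x : x \in F -> exists2 z, z = x \/ z = - x & `|iota x| = iota z.
Proof.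
rewrite (mem_maximal_totally_real iota abK maxF) realE => /orP[x0|x0].
  by exists x; [left | rewrite ger0_norm].
by exists (- x); [right | rewrite ler0_norm ?rmorphN].
Qed.

Lemma absK_eq1 x : x \in F -> absK x = 1 -> x = 1 \/ x = -1.
Proof.
case/absK_sign=> z Dz Dx ax1.
have iz1 : iota z = 1 by rewrite -Dx -absK_val ax1.
have z1 : z = 1 by apply: (fmorph_inj iota); rewrite rmorph1.
by case: Dz => Dz; [left; rewrite -Dz | right; rewrite -z1 Dz opprK].
Qed.

Lemma gal1F (g : gal_of F) : g \in G.
Proof. by rewrite gal_kHom ?sub1v ?k1AHom. Qed.

Lemma galC (g h : gal_of F) x : x \in F -> g (h x) = h (g x).
Proof. by move=> Fx; rewrite -!galM // (centsP abG _ (gal1F g) _ (gal1F h)). Qed.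

Lemma Aint_gal (g : gal_of F) x : x \in F -> iota x \in Aint -> iota (g x) \in Aint.
Proof.
move=> Fx Zx; apply: (@Aint_root_monic (minCpoly (iota x))).
- exact: minCpoly_monic.
- by rewrite minCpoly_iota fmorph_root root_minPoly_gal ?sub1v ?gal1F.
have /polyOverP Zp := Zx; apply/polyOverP=> i; exact: Aint_Cint.
Qed.

Definition unitF x := x \in F /\ algebraic_unit iota x.

Lemma unitF_F x : unitF x -> x \in F. Proof. by case. Qed.
Lemma unitF_Aint x : unitF x -> iota x \in Aint. Proof. by case=> _ []. Qed.

Lemma unitF_neq0 x : unitF x -> x != 0.
Proof.
case=> _ [_ [y _ xy1]]; apply: contra_eq_neq xy1 => ->.
by rewrite mul0r eq_sym oner_neq0.
Qed.

Lemma unitF1 : unitF 1.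
Proof.
split; first exact: rpred1.
by split; [|exists 1]; rewrite ?mulr1 // rmorph1 Aint1.
Qed.

Lemma unitFM x y : unitF x -> unitF y -> unitF (x * y).
Proof.
case=> Fx [Zx [x' Zx' xx']] [Fy [Zy [y' Zy' yy']]]; split; first exact: rpredM.
split; first by rewrite rmorphM rpredM.
by exists (x' * y'); rewrite ?rmorphM ?rpredM // mulrACA xx' yy' mulr1.
Qed.

Lemma unitFN x : unitF x -> unitF (- x).
Proof.
case=> Fx [Zx [y Zy xy1]]; split; first by rewrite rpredN.
by split; [rewrite rmorphN rpredN | exists (- y); rewrite ?mulrNN // rmorphN rpredN].
Qed.

Lemma unitFX x n : unitF x -> unitF (x ^+ n).
Proof.
by move=> Ux; elim: n => [|n IHn]; [apply: unitF1 | rewrite exprS; apply: unitFM].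
Qed.

Lemma unitF_gal (g : gal_of F) x : unitF x -> unitF (g x).
Proof.
move=> Ux; have nz_x := unitF_neq0 Ux; have [Fx [Zx [y Zy xy1]]] := Ux.
have Dy : y = x^-1 by apply: (mulfI nz_x); rewrite xy1 mulfV.
have Fy : y \in F by rewrite Dy rpredV.
split; first exact: memv_gal.
split; first exact: Aint_gal.
by exists (g y); [exact: Aint_gal | rewrite -rmorphM xy1 rmorph1].
Qed.

Lemma unitF_prod (I : Type) (r : seq I) (P : pred I) (f : I -> K) :
  (forall i, P i -> unitF (f i)) -> unitF (\prod_(i <- r | P i) f i).
Proof.
by move=> Uf; elim/big_rec: _ => [|i x Pi Ux]; [apply: unitF1 | apply/unitFM/Ux/Uf].
Qed.

Lemma fixed_rat x : x \in F -> (forall g : gal_of F, g x = x) -> iota x \in Crat.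
Proof.
move=> Fx gx; have: x \in 1%VS.
  by rewrite -(galois_fixedField galF); apply/fixedFieldP.
by case/vlineP=> a ->; rewrite rmorphZ_num rmorph1 mulr1 Crat_rat.
Qed.

(** Both [x] and its inverse are then nonzero rational integers, of absolute value at least 1. *)
Lemma unitF_fixed x : unitF x -> (forall g : gal_of F, g x = x) -> absK x = 1.
Proof.
move=> Ux gx; have [Fx [Zx [y Zy xy1]]] := Ux.
have nz_x := unitF_neq0 Ux.
have Dy : y = x^-1 by apply: (mulfI nz_x); rewrite xy1 mulfV.
have ix := fixed_rat Fx gx.
have nx := Cint_rat_Aint ix Zx.
have ny : iota y \in Num.int.
  by apply: Cint_rat_Aint Zy; rewrite Dy fmorphV rpredV.
have nz_y : iota y != 0 by rewrite fmorph_eq0 Dy invr_eq0.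
have nz_ix : iota x != 0 by rewrite fmorph_eq0.
apply: val_inj; rewrite /=; apply: le_anti; apply/andP; split.
  have: `|iota x| * `|iota y| = 1 by rewrite -normrM -rmorphM xy1 rmorph1 normr1.
  move <-; rewrite ler_peMr ?normr_ge0 //; exact: norm_intr_ge1.
exact: norm_intr_ge1.
Qed.

Lemma mahler_conjugates x (R : seq K) :
    x \in F -> iota x \in Aint -> uniq R -> R =i [seq g x | g : gal_of F in G] ->
  mahler (iota x) = `|iota (\prod_(y <- R | 1 < absK y) y)|.
Proof.
move=> Fx Zx UR DR.
rewrite (mahler_Aint Zx (minCpoly_conjugates iota galF Fx UR DR)) prod_max1.
by rewrite big_map rmorph_prod.
Qed.

Lemma orbit_dprod (A B : {group gal_of F}) x : (A \x B = G)%g -> x \in F ->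
    (forall b, b \in B -> b x = x) ->
  [seq g x | g : gal_of F in G] =i [seq g x | g : gal_of F in A].
Proof.
move=> defG Fx Bx y; apply/imageP/imageP => [[g Gg ->] | [g Ag ->]].
  have [a [b [Aa Bb -> _]]] := mem_dprod defG Gg.
  by exists a; rewrite // galM // galC // Bx.
by exists g => //; apply: gal1F.
Qed.

End RealUnits.

(** * Units with an arc of large conjugates along a cyclic factor *)

Section CyclicFactor.

Variables (K : splittingFieldType rat) (iota : {rmorphism K -> algC}).
Hypothesis abK : abelian_number_field K.
Variable F : {subfield K}.
Hypothesis maxF : maximal_totally_real F.

Local Notation G := ('Gal(F / 1%AS)%g).
Local Notation absK := (absK iota).
Local Notation unitF := (unitF iota F).

Variables (t : gal_of F) (B : {group gal_of F}).
Hypothesis defG : (<[t]> \x B = G)%g.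
Hypothesis t_gt3 : (3 < #[t]%g)%N.

Let n := #[t]%g.

Lemma fixed_by_factors y : y \in F -> t y = y -> (forall b, b \in B -> b y = y) ->
  forall g : gal_of F, g y = y.
Proof.
move=> Fy ty By g; have [a [b [Aa Bb -> _]]] := mem_dprod defG (gal1F g).
have /cycleP[i ->] := Aa; rewrite galM //.
have -> : (t ^+ i)%g y = y.
  by elim: i => [|i IHi]; rewrite ?expg0 ?gal_id // expgSr galM // IHi.
exact: By.
Qed.

(** The product over the cycle of [t] is fixed by [t] and by [B], hence by the whole group. *)
Lemma unitF_cycle_norm x : unitF x -> (forall b, b \in B -> b x = x) ->
  \prod_(i < n) absK ((t ^+ i)%g x) = 1.
Proof.
move=> Ux Bx; have Fx := unitF_F Ux; rewrite -absK_prod; set y := \prod_(i < n) _.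
have Uy : unitF y by apply: unitF_prod => i _; apply: unitF_gal.
apply: (unitF_fixed abK Uy); apply: fixed_by_factors (unitF_F Uy) _ _ => [|b Bb].
  have nz_x : x != 0 by apply: unitF_neq0 Ux.
  apply: (mulfI nz_x); rewrite {2}/y rmorph_prod /=.
  have -> : x * \prod_(i < n) t ((t ^+ i)%g x) = \prod_(i < n.+1) (t ^+ i)%g x.
    rewrite big_ord_recl expg0 gal_id; congr (_ * _); apply: eq_bigr => i _.
    by rewrite -galM // -expgSr.
  by rewrite big_ord_recr /= expg_order gal_id mulrC.
rewrite rmorph_prod; apply: eq_bigr => i _ /=.
by rewrite (galC abK) // (Bx b Bb).
Qed.

(** The start [k] and the length [p] are existential because they change under M; the arc and its
    complement both keep length at least two. *)
Definition arc_unit alpha := exists x k p,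
  [/\ alpha = iota x, unitF x, forall b, b \in B -> b x = x,
      (1 < p)%N /\ (p.+2 <= n)%N
    & forall i, (i < n)%N -> (1 < absK ((t ^+ (k + i))%g x)) = (i < p)%N].

Lemma arc_unit_mahler alpha : arc_unit alpha ->
  arc_unit (mahler alpha) /\ `|alpha| < `|mahler alpha|.
Proof.
case=> x [k [p [-> Ux Bx [p1 pn] arc]]].
have Fx := unitF_F Ux; have Zx := unitF_Aint Ux; have nz_x := unitF_neq0 Ux.
have galt m y : y \in F -> (t ^+ (m + n))%g y = (t ^+ m)%g y.
  by move=> Fy; rewrite expgD expg_order mulg1.
pose L j := absK ((t ^+ (k + j))%g x).
have perL j : L (j + n)%N = L j by rewrite /L addnA galt.
have nz_tx m : (t ^+ m)%g x != 0 by rewrite fmorph_eq0.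
have posL j : 0 < L j by exact: (absK_gt0 iota (nz_tx _)).
have high j : (j < p)%N -> 1 < L j by move=> lt_jp; rewrite arc //; lia.
(* An element of F of absolute value 1 is 1 or -1, so a conjugate of absolute value 1 would force
   the same on [y]. This excludes ties in comparisons with 1. *)
have not1 y : y \in F -> 1 < absK y -> forall g : gal_of F, absK (g y) != 1.
  move=> Fy y1 g; apply: contraTneq y1 => /(absK_eq1 abK maxF (memv_gal g Fy)) gy.
  have : y = 1 \/ y = -1.
    case: gy => gy; [left | right]; apply: (fmorph_inj g).
      by rewrite /= gy rmorph1.
    by rewrite /= gy rmorphN rmorph1.
  by case=> ->; rewrite ?absKN absK1 ltxx.
have low j : (p <= j < n)%N -> L j < 1.
  case/andP=> le_pj lt_jn; rewrite lt_neqAle leNgt arc // -leqNgt le_pj andbT.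
  rewrite /L; have := @not1 ((t ^+ k)%g x) (memv_gal _ Fx).
  have := high 0 ltac:(lia); rewrite /L addn0 => x1 /(_ x1 (t ^+ j)%g).
  rewrite -galM // -expgD. by [].
have normL : \prod_(i < n) L i = 1.
  have Uk : unitF ((t ^+ k)%g x) by apply: unitF_gal.
  have Bk b : b \in B -> b ((t ^+ k)%g x) = (t ^+ k)%g x.
    by move=> Bb; rewrite (galC abK) // (Bx b Bb).
  rewrite -[RHS](unitF_cycle_norm Uk Bk); apply: eq_bigr => i _.
  by rewrite /L -galM // -expgD.
(* [y] is the product over the high arc, equal to M(x) up to sign; the absolute values of its
   translates are the windows of [L]. *)
pose y := \prod_(i < p) (t ^+ (k + i))%g x.
have Wy j : \prod_(i < p) L (j + i)%N = absK ((t ^+ j)%g y).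
  rewrite rmorph_prod absK_prod; apply: eq_bigr => i _.
  rewrite /L /= -galM // -expgD; congr (absK ((t ^+ _)%g x)); lia.
have Uy : unitF y by apply: unitF_prod => i _; apply: unitF_gal.
have Fy := unitF_F Uy.
have By b : b \in B -> b y = y.
  move=> Bb; rewrite rmorph_prod; apply: eq_bigr => i _ /=.
  by rewrite (galC abK) // (Bx b Bb).
have y_gt1 : 1 < absK y.
  have <- : absK ((t ^+ 0)%g y) = absK y by rewrite expg0 gal_id.
  rewrite -Wy; apply: prod_gt1 => [|i]; first by lia.
  by apply: high; have := ltn_ord i; lia.
have W1 j : \prod_(i < p) L (j + i)%N != 1 by rewrite Wy; apply: not1.
have [k' [p' [p'1 p'n arc']]] := window_arc perL posL normL p1 pn high low W1.
pose R := [seq (t ^+ (k + i))%g x | i <- seq.iota 0 n].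
(* A coincidence at distance d < n would make [d] a period of [L], but shifting by [d] moves a high
   index to a low one: 0 to d if d >= p, and p - d to p otherwise. So the n translates of [x] are
   distinct. *)
have gap i d : (0 < d < n)%N -> (t ^+ (k + (i + d)))%g x != (t ^+ (k + i))%g x.
  move=> d_bnd; apply/eqP => eq_d.
  have perd j : L (j + d)%N = L j.
    have tdx : (t ^+ d)%g x = x.
      apply: (fmorph_inj (t ^+ (k + i))%g); rewrite /= -[RHS]eq_d -galM // -expgD.
      by congr ((t ^+ _)%g x); lia.
    rewrite /L -[in RHS]tdx -galM // -expgD; congr (absK ((t ^+ _)%g x)); lia.
  have dp : (d < p)%N.
    rewrite ltnNge; apply/negP=> le_pd; have := low d; have := perd 0%N.
    rewrite add0n => ->; have := high 0%N ltac:(lia) => x1 /(_ ltac:(lia)).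
    by move/(lt_trans x1); rewrite ltxx.
  have := perd (p - d)%N; have -> : (p - d + d = p)%N by lia.
  move=> eq_p; have := low p ltac:(lia); have := high (p - d)%N ltac:(lia).
  by rewrite eq_p => x1 /(lt_trans x1); rewrite ltxx.
have UR : uniq R.
  rewrite map_inj_in_uniq ?iota_uniq // => i j; rewrite !mem_iota !add0n /=.
  move=> lt_in lt_jn eq_ij; case: (ltngtP i j) => // lt_ij.
    have /eqP[] := gap i (j - i)%N ltac:(lia).
    by have -> : (i + (j - i) = j)%N by lia.
  have /eqP[] := gap j (i - j)%N ltac:(lia).
  by have -> : (j + (i - j) = i)%N by lia.
have DR : R =i [seq g x | g : gal_of F in G].
  move=> z; rewrite (orbit_dprod abK defG Fx Bx); apply/mapP/imageP => [[i _ ->]|[g]].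
    by exists (t ^+ (k + i))%g; rewrite ?mem_cycle.
  (* The index is m - k modulo n, written in natural numbers. *)
  case/cycleP=> m -> ->; exists ((m + (n - k %% n)) %% n)%N.
    by rewrite mem_iota add0n ltn_mod order_gt0.
  congr ((_ : gal_of F) x); apply/eqP; rewrite eq_expg_mod_order.
  rewrite modnDmr.
  have -> : (k + (m + (n - k %% n)) = (k %/ n).+1 * n + m)%N.
    by have := divn_eq k n; have := ltn_pmod k (order_gt0 t : 0 < n)%N; rewrite mulSn; lia.
  by rewrite modnMDl.
have Dm : mahler (iota x) = `|iota y|.
  rewrite (mahler_conjugates abK Fx Zx UR DR); congr `|iota _|.
  rewrite big_map -{1}[n]subn0 -/(index_iota 0 n) big_mkord.
  rewrite /y (big_ord_widen n (fun i => (t ^+ (k + i))%g x)); last by lia.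
  by apply: eq_bigl => i; rewrite arc.
have xR : x \in R by rewrite DR; apply/imageP; exists 1%g; rewrite ?gal_id ?gal1F.
split; last first.
  rewrite Dm normr_id; change (absK x < absK y).
  have y_prod : absK y = \prod_(i < p) L i by have /esym := Wy 0%N; rewrite expg0 gal_id.
  have [j + Dx] := mapP xR; rewrite mem_iota add0n /= => lt_jn.
  have -> : absK x = L j by rewrite {1}Dx.
  case: (ltnP j p) => [lt_jp | le_pj].
    (* For [x] inside the arc, a second index [j'] of the arc, available since p > 1, gives a
       further factor above 1. *)
    pose j' := if j is 0 then 1%N else 0%N.
    have lt_j'p : (j' < p)%N by rewrite /j'; case: (j); lia.
    rewrite y_prod (bigD1 (Ordinal lt_jp)) //= (bigD1 (Ordinal lt_j'p)) /=; last first.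
      by rewrite -val_eqE /= /j'; case: (j).
    set c := \prod_(i < p | _) _; have c1 : 1 <= c.
      rewrite /c; apply: (big_ind (fun v => 1 <= v)) => [//||i _].
        exact: mulr_ege1.
      exact/ltW/high.
    rewrite ltr_pMr //; apply: lt_le_trans (high j' lt_j'p) _.
    by rewrite ler_peMr // ltW.
  by apply: lt_trans y_gt1; apply: low; rewrite le_pj.
have [z Dz Ez] := absK_sign iota abK maxF Fy.
rewrite Dm Ez; exists z, k', p'; split=> //.
- by case: Dz => -> //; apply: unitFN.
- by move=> b Bb; case: Dz => ->; rewrite ?rmorphN /= (By b Bb).
move=> i lt_in; rewrite -arc' // Wy.
by case: Dz => -> //; rewrite rmorphN absKN.
Qed.

End CyclicFactor.

(** * A Pisot unit, by pigeonhole *)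

(** The leading coefficient of the primitive minimal polynomial is a denominator. *)
Lemma integral_multiple (z : algC) :
  exists2 d : nat, (0 < d)%N & d%:R * z \in Aint.
Proof.
set a := lead_coef (minZpoly z).
have nz_a : a != 0 by apply: lead_minZpoly_neq0.
exists `|a|%N; first by rewrite absz_gt0.
have Zaz : a%:~R * z \in Aint.
  have := lead_minZpoly z; rewrite -/a => Dp.
  have -> : a%:~R = lead_coef (pZtoC (minZpoly z)).
    by rewrite Dp lead_coefZ (monicP (minCpoly_monic z)) mulr1.
  apply: lead_coef_mul_root; last by rewrite Dp rootE hornerZ (rootP (root_minCpoly z)) mulr0.
  by apply/polyOverP=> i; rewrite coef_map Aint_int.
rewrite -[_%:R]/((`|a|%N%:Z)%:~R) abszE normrEsg rmorphM -mulrA.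
by rewrite rpredM ?Aint_int.
Qed.

Lemma trunc_eq_dist (R : archiRealFieldType) (x y : R) : 0 <= x -> 0 <= y ->
  Num.trunc x = Num.trunc y -> `|x - y| < 1.
Proof.
move=> /truncn_itv/andP[lx ux] /truncn_itv/andP[ly uy] eq_xy.
rewrite eq_xy -natr1 in lx ux; rewrite -natr1 in uy.
by rewrite ltr_norml; apply/andP; split; lra.
Qed.

Section PisotUnit.

Variables (K : splittingFieldType rat) (iota : {rmorphism K -> algC}).
Hypothesis abK : abelian_number_field K.
Variable F : {subfield K}.
Hypothesis maxF : maximal_totally_real F.

Local Notation G := ('Gal(F / 1%AS)%g).
Local Notation absK := (absK iota).
Local Notation unitF := (unitF iota F).

Let galF : galois 1 F := galois_subfield abK F.
Let d := \dim F.

Let card_gal : #|{: gal_of F}| = d.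
Proof.
have := galois_dim galF; rewrite dimv1 divn1 -/d => ->.
by apply: eq_card => g; rewrite gal1F.
Qed.

Let d_gt0 : (0 < d)%N. Proof. exact: adim_gt0. Qed.

(** A rational basis scaled into the algebraic integers: it spans a full lattice in F, possibly
    smaller than the ring of integers. *)
Lemma integral_basis : exists e : 'I_d -> K,
  (forall i, e i \in F /\ iota (e i) \in Aint) /\
  (forall a : 'I_d -> int, \sum_i (a i)%:~R * e i = 0 -> forall i, a i = 0).
Proof.
have [m m_gt0 Zm] : exists2 m : 'I_d -> nat, forall i, (0 < m i)%N &
    forall i, (m i)%:R * iota (vbasis F)`_i \in Aint.
  have [m Hm] := fin_all_exists2 (fun i : 'I_d => integral_multiple (iota (vbasis F)`_i)).
  by move=> Zm; exists m.
exists (fun i => (m i)%:R * (vbasis F)`_i); split=> [i | a a0 i].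
  split; last by rewrite rmorphM rmorph_nat.
  by rewrite rpredM ?rpred_nat // vbasis_mem ?mem_nth ?size_tuple.
have := freeP (basis_free (vbasisP F)) (fun i => (a i * (m i)%:Z)%:~R).
move=> /(_ _ i)/eqP; rewrite intr_eq0 mulf_eq0 => /(_ _)/orP[||]; last first.
- by move=> /eqP[m0]; have := m_gt0 i; rewrite m0.
- by move/eqP.
rewrite -[RHS]a0; apply: eq_bigr => j _.
by rewrite scaler_int mulrzl mulr_natl mulrC mulrzA -pmulrn.
Qed.

Lemma gal_norm_int x : x \in F -> iota x \in Aint ->
  iota (\prod_(g : gal_of F) g x) \in Num.int.
Proof.
move=> Fx Zx; have Fgx (g : gal_of F) : g x \in F by apply: memv_gal.
apply: Cint_rat_Aint; last by rewrite rmorph_prod rpred_prod // => g _; apply: Aint_gal.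
apply: (fixed_rat iota abK) => [|h]; first by apply: rpred_prod => g _; exact: Fgx.
rewrite rmorph_prod /= [RHS](reindex_inj (mulIg h)) /=.
by apply: eq_bigr => g _; rewrite galM.
Qed.

Lemma gal_norm_nat x : x \in F -> iota x \in Aint -> x != 0 ->
  exists2 k : nat, (0 < k)%N & \prod_(g : gal_of F) absK (g x) = k%:R.
Proof.
move=> Fx Zx nz_x; have /intrP[k Dk] := gal_norm_int Fx Zx.
have Dn : \prod_(g : gal_of F) absK (g x) = `|k|%N%:R.
  rewrite -absK_prod; apply: val_inj; rewrite /= Dk -intr_norm -abszE.
  by rewrite rmorph_nat.
exists `|k|%N => //; rewrite absz_gt0; apply/eqP=> k0.
have/eqP := Dn; rewrite k0 /= gt_eqF //; apply: prodr_gt0 => g _.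
by apply: absK_gt0; rewrite fmorph_eq0.
Qed.

(* If the norm k of x divides m then m / x is integral, so y / x = 1 + z * (m / x). *)
Lemma Aint_quotient x y z k m : x \in F -> iota x \in Aint -> x != 0 ->
    \prod_(g : gal_of F) absK (g x) = k%:R -> (k %| m)%N ->
    iota z \in Aint -> y = x + m%:R * z ->
  iota (y / x) \in Aint.
Proof.
move=> Fx Zx nz_x Dk /dvdnP[q ->] Zz ->.
(* The cofactor [c] of [x] in its norm is integral, and [x * c] is k up to sign, so [k / x] is [c]
   up to sign. *)
pose c := \prod_(g : gal_of F | g != 1%g) g x.
have Zc : iota c \in Aint.
  by rewrite rmorph_prod rpred_prod // => g _; apply: Aint_gal.
have Dxc : \prod_(g : gal_of F) g x = x * c by rewrite (bigD1 1%g) //= gal_id.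
have [e e1 De] : exists2 e : int, `|e| = 1 & iota (x * c) = (e * k%:Z)%:~R.
  have /intrP[j Dj] := gal_norm_int Fx Zx; rewrite -Dxc Dj.
  have: `|j|%N = k.
    apply/eqP; rewrite -(eqr_nat algR) -Dk -absK_prod; apply/eqP/val_inj.
    by rewrite /= Dj -intr_norm -abszE rmorph_nat.
  move=> Dj'; have nz_j : j != 0.
    apply: contraTneq nz_x => j0; move: Dj; rewrite Dxc j0 => /eqP.
    rewrite fmorph_eq0 mulf_eq0 negbK => /orP[// |].
    by rewrite prodf_seq_eq0 => /hasP[g _ /andP[_]]; rewrite fmorph_eq0.
  exists (Num.sg j); first by rewrite normr_sg nz_j.
  by rewrite -Dj' abszE -numEsg.
have -> : (x + (q * k)%:R * z) / x = 1 + q%:R * z * (k%:R / x).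
  by rewrite mulrDl divff // natrM; ring.
rewrite rmorphD rmorph1 rmorphM; apply: rpredD; first exact: Aint1.
apply: rpredM.
  by rewrite rmorphM rmorph_nat rpredM // Aint_Cnat ?natr_nat.
have -> : k%:R / x = e%:~R * c.
  apply: (mulIf nz_x); rewrite divfK //; apply: (fmorph_inj iota).
  rewrite rmorph_nat -mulrA [c * x]mulrC rmorphM De rmorph_int -rmorphM /=.
  rewrite mulrA -expr2 -real_normK ?num_real // e1 expr1n mul1r.
  by [].
by rewrite rmorphM rmorph_int rpredM ?Aint_int.
Qed.

(** The signed real value: unlike [absK] it is additive, so that two values in the same box bound a
    difference. *)
Let reK x : algR := in_algR (Creal_Re (iota x)).

Let absK_reK x : x \in F -> absK x = `|reK x|.
Proof.
rewrite (mem_maximal_totally_real iota abK maxF) => /Creal_ReP Rx.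
by apply: val_inj; rewrite /= Rx.
Qed.

Let reKB x y : reK (x - y) = reK x - reK y.
Proof. by apply: val_inj; rewrite /= !raddfB. Qed.

Let absK_sum (I : finType) (f : I -> K) : absK (\sum_i f i) <= \sum_i absK (f i).
Proof.
change (`|iota (\sum_i f i)| <= algRval (\sum_i absK (f i))).
by rewrite !rmorph_sum /= ler_norm_sum.
Qed.

Let absK_ge0 x : 0 <= absK x.
Proof. exact: (normr_ge0 (iota x)). Qed.

Let absK_intl (k : int) x : absK (k%:~R * x) = `|k|%N%:R * absK x.
Proof.
rewrite absKM; congr (_ * _); apply: val_inj.
by rewrite /= rmorph_int -intr_norm -abszE rmorph_nat.
Qed.

(** Dirichlet's box principle on the d - 1 nontrivial conjugates: coefficients up to [t ^ d.-1] give
    more vectors than boxes, so some difference has all these conjugates of order 1/t. Its own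
    absolute value is at most [C * t ^ d.-1], so the norm bound is independent of [t]. *)
Lemma dirichlet_approximation (e : 'I_d -> K) :
    (forall i, e i \in F /\ iota (e i) \in Aint) ->
  exists2 C : nat, (0 < C)%N & forall t : nat, (0 < t)%N ->
  exists2 a : 'I_d -> int, ~ (forall i, a i = 0) &
    (forall g : gal_of F, g != 1%g ->
       absK (g (\sum_i (a i)%:~R * e i)) * t%:R < (3 * C)%:R) /\
    \prod_(g : gal_of F) absK (g (\sum_i (a i)%:~R * e i)) <= (C * (3 * C) ^ d.-1)%:R.
Proof.
move=> Ze; pose X (a : 'I_d -> int) := \sum_i (a i)%:~R * e i.
have FX a : X a \in F.
  by apply: rpred_sum => i _; rewrite rpredM ?rpred_int //; case: (Ze i).
pose M : algR := \sum_(g : gal_of F) \sum_i absK (g (e i)).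
have M_ge0 : 0 <= M by apply: sumr_ge0 => g _; apply: sumr_ge0.
pose C := Num.bound M; have ltMC : M < C%:R by apply: archi_boundP.
have C_gt0 : (0 < C)%N by rewrite -(ltr_nat algR); apply: le_lt_trans ltMC.
have bndX A a (g : gal_of F) : (forall i, (`|a i| <= A)%N) -> absK (g (X a)) <= (A * C)%:R.
  move=> leA; rewrite /X rmorph_sum /=; apply: le_trans (absK_sum _) _.
  apply: (@le_trans _ _ (\sum_i A%:R * absK (g (e i)))).
    by apply: ler_sum => i _; rewrite rmorphM rmorph_int absK_intl ler_wpM2r ?ler_nat.
  rewrite -mulr_sumr natrM ler_wpM2l //; apply: le_trans (ltW ltMC).
  by rewrite /M (bigD1 g) //= lerDl; apply: sumr_ge0 => h _; apply: sumr_ge0.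
exists C => // t t_gt0; pose A := (t ^ d.-1)%N; pose T := (t ^ d)%N.
have DT : T = (t * A)%N by rewrite -expnS prednK.
have T_gt0 : (0 < T)%N by rewrite expn_gt0 t_gt0.
(* The values shifted by [A * C] lie in [0, 2AC]; scaling by t/(3C) rather than t/(2C) keeps them
   strictly below [T]. *)
pose c3 : algR := t%:R / (3 * C)%:R.
have C30 : 0 < (3 * C)%:R :> algR by rewrite ltr0n muln_gt0.
have t0 : 0 < t%:R :> algR by rewrite ltr0n.
have c30 : 0 < c3 by apply: divr_gt0.
pose N (a : {ffun 'I_d -> 'I_A.+1}) := X (fun i => (a i : nat)%:Z).
pose v a (g : gal_of F) := (reK (g (N a)) + (A * C)%:R) * c3.
have FN a (g : gal_of F) : g (N a) \in F by apply/memv_gal/FX.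
have v_bnd a (g : gal_of F) : 0 <= v a g < T%:R.
  have : `|reK (g (N a))| <= (A * C)%:R.
    by rewrite -absK_reK ?FN //; apply: bndX => i; apply: leq_ord.
  rewrite ler_norml => /andP[lo hi]; apply/andP; split.
    by rewrite mulr_ge0 ?(ltW c30) // -lerBlDr sub0r.
  rewrite /v /c3 mulrA ltr_pdivrMr //; apply: (@le_lt_trans _ _ ((A * C)%:R * 2 * t%:R)).
    by rewrite ler_pM2r // mulrDr mulr1 lerD2r.
  rewrite DT -!natrM ltr_nat.
  have : (0 < t * A * C)%N by rewrite -DT muln_gt0 T_gt0.
  by nia.
pose S := {g : gal_of F | g != 1%g}.
pose f a : {ffun S -> 'I_T.-1.+1} := [ffun s : S => inord (Num.trunc (v a (val s)))].
(* There are (A + 1)^d vectors against T^(d-1) = A^d boxes. *)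
have /injectivePn[a [b neq_ab eq_f]] : ~~ injectiveb f.
  apply/injectiveP=> /leq_card; rewrite !card_ffun !card_ord card_sig.
  have -> : #|[pred g : gal_of F | g != 1%g]| = d.-1 by rewrite -card_gal -(cardC1 1%g).
  rewrite prednK // /T /A -expnM mulnC expnM leqNgt; case/negP.
  by rewrite ltn_exp2r.
exists (fun i => (a i : nat)%:Z - (b i : nat)%:Z).
  move=> eq0; case/eqP: neq_ab; apply/ffunP=> i; apply/val_inj => /=.
  by have /eqP := eq0 i; rewrite subr_eq0 => /eqP[].
have DX : \sum_i ((a i : nat)%:Z - (b i : nat)%:Z)%:~R * e i = N a - N b.
  by rewrite -sumrB; apply: eq_bigr => i _; rewrite rmorphB mulrBl.
have small (g : gal_of F) : g != 1%g -> absK (g (N a - N b)) * t%:R < (3 * C)%:R.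
  move=> g1; have := congr1 (fun h : {ffun _ -> _} => nat_of_ord (h (Sub g g1 : S))) eq_f.
  have [a0 aT] := andP (v_bnd a g); have [b0 bT] := andP (v_bnd b g).
  rewrite !ffunE /= !inordK ?prednK //; last 2 first.
  - by rewrite -(ltr_nat algR); apply: le_lt_trans bT; have /andP[] := truncn_itv b0.
  - by rewrite -(ltr_nat algR); apply: le_lt_trans aT; have /andP[] := truncn_itv a0.
  move/(trunc_eq_dist a0 b0).
  rewrite /v -mulrBl opprD addrACA subrr addr0 -reKB -rmorphB normrM (gtr0_norm c30) /=.
  rewrite -absK_reK; last by rewrite rmorphB rpredB ?FN.
  by rewrite /c3 mulrA ltr_pdivrMr // mul1r.
rewrite DX; split=> //.
have tA : \prod_(g : gal_of F | g != 1%g) t%:R = A%:R :> algR.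
  by rewrite prodr_const natrX; congr (_ ^+ _); rewrite -card_gal -(cardC1 1%g).
have cC : \prod_(g : gal_of F | g != 1%g) (3 * C)%:R = ((3 * C) ^ d.-1)%:R :> algR.
  by rewrite prodr_const natrX; congr (_ ^+ _); rewrite -card_gal -(cardC1 1%g).
have A0 : 0 < A%:R :> algR by rewrite ltr0n expn_gt0 t_gt0.
(* Multiplying by A = t^(d-1) hands one factor [t] to each nontrivial conjugate, which [small] then
   bounds by [3 * C]. *)
rewrite -(ler_pM2r A0) (bigD1 1%g) //= -mulrA -tA -big_split /= natrM -cC.
rewrite [leRHS]mulrAC [in leRHS]tA -natrM mulnC; apply: ler_pM => //.
- by apply: prodr_ge0 => g _; rewrite mulr_ge0 ?(ltW t0).
- rewrite gal_id -DX -[X in absK X](gal_id F); apply: bndX => i.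
  by have := ltn_ord (a i); have := ltn_ord (b i); lia.
by apply: ler_prod => g g1; rewrite mulr_ge0 ?(ltW t0) //= ltW ?small.
Qed.

(** Two approximants congruent modulo a multiple of both norms divide each other, so their quotient
    is a unit. [b] is chosen after [a], with [t] so large that each nontrivial conjugate of [X b] is
    smaller than that of [X a]. *)
Theorem pisot_unit : exists2 u, unitF u &
  forall g : gal_of F, g != 1%g -> absK (g u) < 1.
Proof.
have [e [Ze free_e]] := integral_basis.
have [C C_gt0 apx] := dirichlet_approximation Ze.
pose X (a : 'I_d -> int) := \sum_i (a i)%:~R * e i.
have FX a : X a \in F.
  by apply: rpred_sum => i _; rewrite rpredM ?rpred_int //; case: (Ze i).
have ZX a : iota (X a) \in Aint.
  rewrite rmorph_sum rpred_sum // => i _.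
  by rewrite rmorphM rmorph_int rpredM ?Aint_int //; case: (Ze i).
(* The norms of approximants are positive integers up to this bound, hence all divide the
   factorial. *)
pose m := (C * (3 * C) ^ d.-1)`!.
have m_gt0 : (0 < m)%N by apply: fact_gt0.
pose key (a : 'I_d -> int) : {ffun 'I_d -> 'I_m.+1} :=
  [ffun i => inord `|(a i %% m)%Z|%N].
have keyE a b : key a = key b -> exists c, X a = X b + m%:R * X c.
  move=> eq_ab; have dv i : (m %| a i - b i)%Z.
    rewrite -eqz_mod_dvd; have := congr1 (fun f : {ffun _ -> _} => nat_of_ord (f i)) eq_ab.
    have lt_m (c : int) : (`|(c %% m)%Z| < m.+1)%N.
      by rewrite ltnS -lez_nat abszE ger0_norm ?modz_ge0 ?ltW ?ltz_pmod //; lia.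
    rewrite !ffunE !inordK // => /(congr1 Posz).
    by rewrite !abszE !ger0_norm ?modz_ge0 //; try lia; move=> ->.
  exists (fun i => (a i - b i) %/ m)%Z; rewrite mulr_sumr -big_split.
  apply: eq_bigr => i _ /=; have := divzK (dv i).
  move=> /(congr1 (fun z : int => z%:~R : K)); rewrite rmorphM rmorphB /= => E.
  by rewrite mulrA -mulrDl [m%:R * _]mulrC E addrC subrK.
pose good t a := [/\ ~ (forall i, a i = 0),
    forall g : gal_of F, g != 1%g -> absK (g (X a)) * t%:R < (3 * C)%:R
  & \prod_(g : gal_of F) absK (g (X a)) <= (C * (3 * C) ^ d.-1)%:R].
(* One residue class has approximants for every [t]. Otherwise each of the finitely many classes
   fails at some [T kap]; an approximant for the largest of these is also good for the smaller ones,
   hence contradicts the failure of its own class. *)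
have [kap rec] : exists kap, forall t, (0 < t)%N -> exists2 a, key a = kap & good t a.
  apply: NNPP => no_kap.
  have /fin_all_exists[T HT] : forall kap, exists s, (0 < s)%N /\
      forall a, key a = kap -> ~ good s a.
    move=> kap; have := not_ex_all_not _ _ no_kap kap.
    move/not_all_ex_not=> [s Hs]; have [s_gt0 no_a] := imply_to_and _ _ Hs.
    by exists s; split=> [|a ka ga]; [exact: s_gt0 | apply: no_a; exists a].
  pose t := \max_kap T kap.
  have t_gt0 : (0 < t)%N.
    have := leq_bigmax (F := T) (key (fun=> 0)).
    by case: (HT (key (fun=> 0))); rewrite -/t; lia.
  have [a nz_a [small bnd]] := apx t t_gt0; have [_] := HT (key a).
  move=> /(_ a erefl); apply; split=> // g g1; apply: le_lt_trans (small g g1).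
  by rewrite ler_wpM2l ?ler_nat ?(leq_bigmax (F := T)) //; change (0 <= `|iota (g (X a))|).
have nzX a t : good t a -> X a != 0.
  by case=> nz_a _ _; apply/eqP=> /free_e.
have [a ka ga] := rec 1%N isT; have nz_a := nzX a _ ga.
have /fin_all_exists[T HT] : forall g : gal_of F, exists s : nat,
    (3 * C)%:R < absK (g (X a)) * s%:R.
  move=> g; exists (Num.bound ((3 * C)%:R / absK (g (X a)))).
  have ag : 0 < absK (g (X a)) by apply: absK_gt0; rewrite fmorph_eq0.
  by rewrite mulrC -ltr_pdivrMr // archi_boundP // divr_ge0 ?ler0n // ltW.
pose t := \max_g T g.
have t_gt0 : (0 < t)%N.
  have := leq_bigmax (F := T) 1%g; have := HT 1%g.
  case: (T 1%g) => [|k]; last by rewrite -/t; lia.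
  by rewrite mulr0 ltrn0.
have [b kb gb] := rec t t_gt0; have nz_b := nzX b _ gb.
have norm_dvd c s : good s c ->
    exists2 k, \prod_(g : gal_of F) absK (g (X c)) = k%:R & (k %| m)%N.
  move=> gc; have [k k_gt0 Dk] := gal_norm_nat (FX c) (ZX c) (nzX c _ gc).
  exists k => //; apply: dvdn_fact; rewrite k_gt0 /=.
  by case: gc => _ _; rewrite Dk ler_nat.
have quo c c' s : good s c -> key c' = key c -> iota (X c' / X c) \in Aint.
  move=> gc /keyE[z Dz]; have [k Dk dv_k] := norm_dvd c s gc.
  exact: (Aint_quotient (FX c) (ZX c) (nzX c _ gc) Dk dv_k (ZX z) Dz).
exists (X b / X a).
  split; first by apply: rpredM; rewrite ?rpredV; exact: FX.
  split; first by apply: (quo _ _ 1%N) => //; rewrite ka.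
  exists (X a / X b); first by apply: (quo _ _ t) => //; rewrite ka.
  by rewrite mulrA divfK // divff.
move=> g g1; have ag : 0 < absK (g (X a)) by apply: absK_gt0; rewrite fmorph_eq0.
have -> : absK (g (X b / X a)) = absK (g (X b)) / absK (g (X a)).
  apply: (mulIf (lt0r_neq0 ag)); rewrite divfK ?lt0r_neq0 //.
  by rewrite -absKM -rmorphM divfK.
rewrite ltr_pdivrMr // mul1r.
have [_ /(_ g g1) small _] := gb.
have t0 : 0 < t%:R :> algR by rewrite ltr0n.
rewrite -(ltr_pM2r t0); apply: lt_trans small _; apply: lt_le_trans (HT g) _.
by rewrite ler_pM2l // ler_nat (leq_bigmax (F := T)).
Qed.

End PisotUnit.

(** * Direct factors of the Galois group *)

Section Balance.

Variable R : archiRealFieldType.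
Implicit Types a b c x : R.

Lemma cofactor_gt1 x c : x * c = 1 -> 0 < c < 1 -> 1 < x.
Proof.
move=> xc /andP[c0 c1]; have -> : x = c^-1.
  by apply: (mulIf (lt0r_neq0 c0)); rewrite xc mulVf ?lt0r_neq0.
by rewrite invf_gt1.
Qed.

Lemma cofactor_lt1 x c : x * c = 1 -> 1 < x -> c < 1.
Proof.
move=> xc x1; have x0 : 0 < x by apply: lt_trans x1.
have -> : c = x^-1 by apply: (mulfI (lt0r_neq0 x0)); rewrite xc divff ?lt0r_neq0.
by rewrite invf_lt1.
Qed.

(** Bernoulli's inequality and the archimedean property. *)
Lemma exp_unbounded a x : 1 < a -> exists2 n, (0 < n)%N & x < a ^+ n.
Proof.
move=> a1; have bern n : 1 + n%:R * (a - 1) <= a ^+ n.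
  elim: n => [|n IHn]; first by rewrite mul0r addr0 expr0.
  rewrite exprS -natr1; apply: (@le_trans _ _ (a * (1 + n%:R * (a - 1)))).
    have : 0 <= n%:R * (a - 1) ^+ 2 by rewrite mulr_ge0 ?sqr_ge0.
    by rewrite expr2; lra.
  by rewrite ler_pM2l //; lra.
have a0 : 0 < a - 1 by rewrite subr_gt0.
exists (Num.bound (`|x| / (a - 1))).+1 => //; apply: lt_le_trans (bern _).
have : `|x| / (a - 1) < (Num.bound (`|x| / (a - 1)))%:R.
  by apply: archi_boundP; rewrite divr_ge0 // ltW.
rewrite ltr_pdivrMr // -natr1 => lt_x; have := ler_norm x.
by set N := _%:R in lt_x *; nra.
Qed.

Lemma exp_bracket a x : 1 < a -> 1 <= x ->
  exists2 n, (0 < n)%N & x < a ^+ n /\ a ^+ n.-1 <= x.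
Proof.
move=> a1 x1; have [m _ xm] := exp_unbounded x a1.
case: (ex_minnP (ex_intro (fun n => x < a ^+ n) m xm)) => n xn min_n.
have n_gt0 : (0 < n)%N by case: n xn {min_n}; rewrite // expr0 ltNge x1.
exists n => //; split=> //; rewrite leNgt; apply/negP=> /min_n; lia.
Qed.

(** Take p with [b1 < (a / a1) ^ p], then the least q with [a1 ^ p < b ^ q]. Minimality gives [b1 ^
    q <= b1 * b ^ q.-1 <= b1 * a1 ^ p < a ^ p]. *)
Lemma balance2 a1 a b1 b : 1 <= a1 -> a1 < a -> 1 <= b1 -> b1 < b ->
  exists p q, [/\ (0 < p)%N, (0 < q)%N, a1 ^+ p < b ^+ q & b1 ^+ q < a ^+ p].
Proof.
move=> a1_1 lt_a b1_1 lt_b; have a10 : 0 < a1 by lra.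
have [p p_gt0 lt_p] : exists2 p, (0 < p)%N & b1 < (a / a1) ^+ p.
  by apply: exp_unbounded; rewrite ltr_pdivlMr ?mul1r.
have [q q_gt0 [lo hi]] : exists2 q, (0 < q)%N & a1 ^+ p < b ^+ q /\ b ^+ q.-1 <= a1 ^+ p.
  by apply: exp_bracket; rewrite ?exprn_ege1 //; lra.
exists p, q; split=> //.
have a1p : 0 < a1 ^+ p by apply: exprn_gt0.
rewrite expr_div_n ltr_pdivlMr // in lt_p; apply: le_lt_trans lt_p.
rewrite -(prednK q_gt0) exprS ler_pM2l; last by lra.
by apply: le_trans hi; rewrite lerXn2r ?nnegrE; lra.
Qed.

(** Triangle inequalities for logarithms. With [b * c < a ^ p] and q, r least such that [b ^ q] and
    [c ^ r] exceed [a ^ p], the three powers agree up to factors [b] and [c], which are below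
    [a ^ p]. *)
Lemma balance3 a b c : 1 < a -> 1 < b -> 1 < c -> exists p q r,
  [/\ (0 < p)%N /\ (0 < q)%N /\ (0 < r)%N, a ^+ p < b ^+ q * c ^+ r,
      b ^+ q < a ^+ p * c ^+ r & c ^+ r < a ^+ p * b ^+ q].
Proof.
move=> a1 b1 c1; have [p p_gt0 lt_p] := exp_unbounded (b * c) a1.
have ap1 : 1 < a ^+ p by apply: lt_trans lt_p; nra.
have bc1 : b < a ^+ p by apply: lt_trans lt_p; nra.
have bc2 : c < a ^+ p by apply: lt_trans lt_p; nra.
have [q q_gt0 [lob hib]] := exp_bracket b1 (ltW ap1).
have [r r_gt0 [loc hic]] := exp_bracket c1 (ltW ap1).
have hb : b ^+ q <= b * a ^+ p by rewrite -(prednK q_gt0) exprS ler_pM2l //; lra.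
have hc : c ^+ r <= c * a ^+ p by rewrite -(prednK r_gt0) exprS ler_pM2l //; lra.
by exists p, q, r; split=> //; nra.
Qed.

End Balance.

(** * Units attached to a direct factor, and the cyclic case *)

Section FactorUnits.

Variables (K : splittingFieldType rat) (iota : {rmorphism K -> algC}).
Hypothesis abK : abelian_number_field K.
Variable F : {subfield K}.
Hypothesis maxF : maximal_totally_real F.

Local Notation G := ('Gal(F / 1%AS)%g).
Local Notation absK := (absK iota).
Local Notation unitF := (unitF iota F).

(** [v] is the norm of a Pisot unit along [B]. For nontrivial [a] in [A] no product of [a] with an
    element of [B] is 1, so all the factors of [a v] are below 1. *)
Lemma pisot_factor (A B : {group gal_of F}) : (A \x B = G)%g ->
  exists v, [/\ unitF v, forall b, b \in B -> b v = v
    & forall a, a \in A -> a != 1%g -> absK (a v) < 1].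
Proof.
move=> defG; have [u Uu lt1] := pisot_unit iota abK maxF.
have Fu := unitF_F Uu; have [_ _ _ tiAB] := dprodP defG.
exists (\prod_(b in B) b u); split.
- by apply: unitF_prod => b _; apply: unitF_gal.
- move=> b Bb; rewrite rmorph_prod /= [RHS](reindex_inj (mulIg b)) /=.
  apply: eq_big => [c | c _]; first by rewrite groupMr.
  by rewrite galM.
move=> a Aa a1; have lt_b b : b \in B -> 0 <= absK (a (b u)) < 1.
  move=> Bb; apply/andP; split; first exact: (normr_ge0 (iota _)).
  rewrite -galM //; apply: lt1; apply: contraNneq a1 => ba1.
  have Ba : a \in B by move/eqP: ba1; rewrite -eq_invg_mul => /eqP<-; rewrite groupV.
  have: a \in A :&: B by rewrite inE Aa.
  by rewrite tiAB => /set1P->.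
rewrite rmorph_prod absK_prod (bigD1 1%g) //=.
have /andP[x0 x1] := lt_b 1%g (group1 B); apply: le_lt_trans x1.
rewrite ler_piMr //; set c := \prod_(b in B | _) _.
suff /andP[] : 0 <= c <= 1 by [].
rewrite /c; apply: (big_ind (fun v => 0 <= v <= 1)).
- by rewrite ler01 lexx.
- by move=> v w /andP[v0 v1] /andP[w0 w1]; rewrite mulr_ge0 //= mulr_ile1.
by move=> b /andP[Bb _]; have /andP[-> /ltW->] := lt_b b Bb.
Qed.

(** The orbit starts at [v * t v], whose i-th translate has absolute value [V i * V i.+1]. It
    exceeds 1 only when the dominant [V 0] is a factor, for i = n - 1 and i = 0: an arc of length
    two. *)
Theorem cyclic_wandering (t : gal_of F) (B : {group gal_of F}) :
    (<[t]> \x B = G)%g -> (3 < #[t]%g)%N ->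
  exists2 u, unitF u & wandering (iota u).
Proof.
move=> defG t_gt3; have [v [Uv Bv lt1]] := pisot_factor defG.
have Fv := unitF_F Uv; set n := #[t]%g in t_gt3 *.
pose V i := absK ((t ^+ i)%g v).
have V0 i : 0 < V i.
  by apply: (absK_gt0 iota); rewrite fmorph_eq0; apply: unitF_neq0 Uv.
have Vn i : V (i + n)%N = V i by rewrite /V expgD expg_order mulg1.
have Vlt i : (0 < i < n)%N -> V i < 1.
  case/andP=> i0 lt_in; apply: lt1; first exact: mem_cycle.
  rewrite -order_dvdn -/n; apply: contraL lt_in => /(dvdn_leq i0).
  by rewrite -leqNgt.
have normV : \prod_(i < n) V i = 1 by apply: (unitF_cycle_norm abK defG Uv Bv).
(* [c] collects the other small conjugates, so [V 0 * V 1] and [V 0 * V n.-1] are inverses of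
   products of small conjugates. *)
have [c c01 Dc] : exists2 c, 0 < c < 1 & V 0 * V 1 * V n.-1 * c = 1.
  have [m Dn] : exists m, n = m.+3 by exists (n - 3)%N; lia.
  exists (\prod_(i < m) V i.+2).
    rewrite prodr_gt0 //=; apply: prod_lt1 => [|i]; first by lia.
    by rewrite V0 Vlt //; have := ltn_ord i; lia.
  rewrite -[RHS]normV Dn 2!big_ord_recl big_ord_recr /= /bump /= add1n -!mulrA.
  by congr (_ * (_ * _)); rewrite mulrC; congr (_ * _); apply: eq_bigr => i _; congr V; lia.
have Ut : unitF (v * t v) by apply: unitFM => //; apply: unitF_gal.
exists (v * t v) => //.
apply: (wandering_of_increasing (Q := arc_unit iota t B)); last first.
  by move=> b; apply: arc_unit_mahler.
exists (v * t v), n.-1, 2%N; split=> //.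
  by move=> b Bb; rewrite rmorphM /= (galC abK) // Bv.
move=> i lt_in.
have -> : absK ((t ^+ (n.-1 + i))%g (v * t v)) = V (n.-1 + i)%N * V (n + i)%N.
  rewrite rmorphM absKM /= -galM // -expgS; congr (_ * absK ((t ^+ _)%g v)); lia.
have [c0 c1] := andP c01; have [v0 v1 v2] := And3 (V0 0%N) (V0 1%N) (V0 n.-1).
have V1lt := Vlt 1%N ltac:(lia); have Vmlt := Vlt n.-1 ltac:(lia).
case: i lt_in => [|[|i]] lt_in.
- rewrite addn0 addnC Vn; apply: (cofactor_gt1 (c := V 1%N * c)); first by rewrite -Dc; ring.
  by rewrite mulr_gt0 ?mulr_ilt1 ?ltW.
- have -> : V (n.-1 + 1)%N = V 0%N by rewrite -(Vn 0%N); congr V; lia.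
  rewrite addnC Vn; apply: (cofactor_gt1 (c := V n.-1 * c)); first by rewrite -Dc; ring.
  by rewrite mulr_gt0 ?mulr_ilt1 ?ltW.
have -> : V (n.-1 + i.+2)%N = V i.+1 by rewrite -(Vn i.+1); congr V; lia.
rewrite [V (n + _)%N](_ : _ = V i.+2); last by rewrite addnC Vn.
rewrite ltNge; apply/negbF/ltW.
have l1 := Vlt i.+1 ltac:(lia); have l2 := Vlt i.+2 ltac:(lia).
by rewrite mulr_ilt1 ?ltW.
Qed.

End FactorUnits.

(** * Square orbits *)

Section SquareOrbits.

Variables (K : splittingFieldType rat) (iota : {rmorphism K -> algC}).
Hypothesis abK : abelian_number_field K.
Variable F : {subfield K}.
Hypothesis maxF : maximal_totally_real F.

Local Notation G := ('Gal(F / 1%AS)%g).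
Local Notation absK := (absK iota).
Local Notation unitF := (unitF iota F).

Lemma mahler_indexed (I : eqType) (r : seq I) (f : I -> K) (high : pred I) x :
    unitF x -> (forall g : gal_of F, exists2 q, q \in r & g x = f q) ->
    (forall q, exists g : gal_of F, f q = g x) -> uniq (map f r) ->
    (forall q, (1 < absK (f q)) = high q) ->
  mahler (iota x) = `|iota (\prod_(q <- r | high q) f q)|.
Proof.
move=> Ux orb1 orb2 Ur Dhigh.
rewrite (mahler_conjugates abK (unitF_F Ux) (unitF_Aint Ux) Ur).
  by rewrite big_map; under eq_bigl do rewrite Dhigh.
move=> z; apply/mapP/imageP => [[q _ ->] | [g _ ->]].
  by have [g ->] := orb2 q; exists g; rewrite ?gal1F.
by have [q rq ->] := orb1 g; exists q.
Qed.

Lemma cycle_factor_orbit (s : gal_of F) (B : {group gal_of F}) y n :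
    (<[s]> \x B = G)%g -> #[s]%g = n -> y \in F -> (forall b, b \in B -> b y = y) ->
  forall g : gal_of F, exists2 i, (i < n)%N & g y = (s ^+ i)%g y.
Proof.
move=> defG os Fy By g.
have [a [b [/cyclePmin[i lt_i ->] Bb -> _]]] := mem_dprod defG (gal1F g).
by exists i; [rewrite -os | rewrite galM // (galC abK) // By].
Qed.

(** By the norm relation the inverse of one small value is [Y 0] times the other, hence below [Y 0].
    The gap between [a] and [Y 0] is the room that [balance2] uses. *)
Lemma dominant_inverse (Y : nat -> algR) : (forall i, 0 < Y i) ->
    (forall i, (0 < i < 3)%N -> Y i < 1) -> Y 0%N * Y 1%N * Y 2 = 1 ->
  exists a, [/\ 1 <= a, a < Y 0%N & forall i, (0 < i < 3)%N -> 1 <= a * Y i].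
Proof.
move=> Y0 Y1 YN; have lt1 := Y1 1%N isT; have lt2 := Y1 2 isT.
have [p1 p2] := (Y0 1%N, Y0 2).
exists (Num.max (Y 1%N)^-1 (Y 2)^-1); split.
- by rewrite le_max invf_ge1 // ltW.
- have -> : (Y 1%N)^-1 = Y 0%N * Y 2.
    by apply: (mulIf (lt0r_neq0 p1)); rewrite mulVf ?lt0r_neq0 // -YN; ring.
  have -> : (Y 2)^-1 = Y 0%N * Y 1%N.
    by apply: (mulIf (lt0r_neq0 p2)); rewrite mulVf ?lt0r_neq0.
  by rewrite gt_max !gtr_pMr ?Y0 ?lt1 ?lt2.
by move=> [|[|[|i]]] // _; rewrite -ler_pdivrMr // mul1r le_max lexx ?orbT.
Qed.

Definition grid3 : seq (nat * nat) :=
  [:: (0, 0); (0, 1); (0, 2); (1, 0); (1, 1); (1, 2); (2, 0); (2, 1); (2, 2)]%N.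

Definition cross (q : nat * nat) := (q.1 %% 3 == 0)%N || (q.2 %% 3 == 0)%N.

(** A finite check. It separates conjugates: equal ones would have the same pattern of translates of
    absolute value above 1. *)
Lemma cross_inj : {in grid3 &, forall q q',
  (forall k l, cross (q.1 + k, q.2 + l)%N = cross (q'.1 + k, q'.2 + l)%N) -> q = q'}.
Proof.
have: all (fun q => all (fun q' => (q == q') || has (fun d : nat * nat =>
   cross (q.1 + d.1, q.2 + d.2)%N != cross (q'.1 + d.1, q'.2 + d.2)%N) grid3) grid3) grid3.
  by [].
move=> /allP inj q q' /inj/allP{}inj /inj /orP[/eqP// | /hasP[[k l] _ /eqP ne] eq].
by case: ne; apply: eq.
Qed.

(** * Two factors of order three *)

Section ThreeThree.

Variables (s t : gal_of F) (Bs Bt : {group gal_of F}).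
Hypotheses (defGs : (<[s]> \x Bs = G)%g) (defGt : (<[t]> \x Bt = G)%g).
Hypotheses (os : #[s]%g = 3%N) (ot : #[t]%g = 3%N).
Hypotheses (Bs_t : t \in Bs) (Bt_s : s \in Bt).

Let Y y i := absK ((s ^+ i)%g y).
Let Z z i := absK ((t ^+ i)%g z).

(** These inequalities force the conjugate of [y * z] at (i, j) to exceed 1 in absolute value
    exactly on [cross]. *)
Definition cross_pair y z :=
  [/\ unitF y, unitF z, forall b, b \in Bs -> b y = y, forall b, b \in Bt -> b z = z
    & forall i, (0 < i < 3)%N ->
      [/\ Y y i < 1, Z z i < 1, 1 < Y y i * Z z 0 & 1 < Y y 0 * Z z i]].

Lemma cross_pair_mahler y z : cross_pair y z ->
  exists y' z', cross_pair y' z' /\ mahler (iota (y * z)) = iota (y' * z') /\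
    `|iota (y * z)| < `|iota (y' * z')|.
Proof.
case=> Uy Uz By Bz bnd; have [Fy Fz] := (unitF_F Uy, unitF_F Uz).
pose f (q : nat * nat) := (s ^+ q.1)%g y * (t ^+ q.2)%g z.
have Ux := unitFM Uy Uz.
have shift i j k l : (t ^+ l)%g ((s ^+ k)%g (f (i, j))) = f (i + k, j + l)%N.
  rewrite /f !rmorphM /=; congr (_ * _).
    rewrite -[(s ^+ k)%g _]galM // -expgD (galC abK) //.
    by rewrite (By (t ^+ l)%g) // groupX.
  rewrite (galC abK) ?memv_gal // -[(t ^+ l)%g _]galM // -expgD (galC abK) //.
  by rewrite (Bz (s ^+ k)%g) // groupX.
have fmod i j : f (i, j) = f (i %% 3, j %% 3)%N.
  by rewrite /f /= -{1}os -{1}ot !expg_mod_order.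
have Y1 : Y y 0 * Y y 1 * Y y 2 = 1.
  have := unitF_cycle_norm abK defGs Uy By.
  by rewrite os !big_ord_recr big_ord0 /= mul1r.
have Z1 : Z z 0 * Z z 1 * Z z 2 = 1.
  have := unitF_cycle_norm abK defGt Uz Bz.
  by rewrite ot !big_ord_recr big_ord0 /= mul1r.
have Ypos i : 0 < Y y i by apply: (absK_gt0 iota); rewrite fmorph_eq0; apply: unitF_neq0 Uy.
have Zpos i : 0 < Z z i by apply: (absK_gt0 iota); rewrite fmorph_eq0; apply: unitF_neq0 Uz.
have [y1 z1 yz1 zy1] := bnd 1%N isT; have [y2 z2 yz2 zy2] := bnd 2%N isT.
have Y0 : 1 < Y y 0.
  by apply: (cofactor_gt1 (c := Y y 1 * Y y 2)); rewrite ?mulrA // mulr_gt0 ?mulr_ilt1 ?ltW.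
have Z0 : 1 < Z z 0.
  by apply: (cofactor_gt1 (c := Z z 1 * Z z 2)); rewrite ?mulrA // mulr_gt0 ?mulr_ilt1 ?ltW.
have absf q : absK (f q) = Y y q.1 * Z z q.2 by rewrite /f absKM.
have high q : (1 < absK (f q)) = cross q.
  case: q => i j; rewrite fmod absf /cross /=.
  have := ltn_pmod i (isT : 0 < 3)%N; have := ltn_pmod j (isT : 0 < 3)%N.
  by move: (i %% 3)%N (j %% 3)%N => [|[|[|//]]] [|[|[|//]]] _ _;
     first [by [] | by rewrite mulr_egt1
           | by apply/negbTE; rewrite -leNgt ltW ?mulr_ilt1 ?ltW].
have uniq_f : uniq (map f grid3).
  rewrite map_inj_in_uniq // => -[i j] [i' j'] gij gij' eq_f; apply: cross_inj => // k l.
  by rewrite -!high /= -!shift eq_f.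
have orb1 (g : gal_of F) : exists2 q, q \in grid3 & g (y * z) = f q.
  have [i lt_i Dy] := cycle_factor_orbit defGs os Fy By g.
  have [j lt_j Dz] := cycle_factor_orbit defGt ot Fz Bz g.
  exists (i, j); last by rewrite rmorphM /= Dy Dz.
  by case: i j lt_i lt_j {Dy Dz} => [|[|[|//]]] [|[|[|//]]].
have orb2 q : exists g : gal_of F, f q = g (y * z).
  case: q => i j; exists (s ^+ i * t ^+ j)%g.
  have := shift 0%N 0%N i j; rewrite !add0n => <-.
  by rewrite galM ?rpredM // /f /= !expg0 !gal_id.
have := mahler_indexed Ux orb1 orb2 uniq_f high.
set p := \prod_(q <- _ | _) _ => Dm.
(* On the cross [Y y 0] and [Z z 0] occur three times and the other values once; the norm relations
   leave a square. *)
have absp : absK p = (Y y 0 * Z z 0) ^+ 2.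
  rewrite absK_prod (eq_bigr _ (fun q _ => absf q)) /grid3 !big_cons big_nil /=.
  transitivity ((Y y 0 * Y y 1 * Y y 2) * (Z z 0 * Z z 1 * Z z 2) * (Y y 0 * Z z 0) ^+ 2).
    by ring.
  by rewrite Y1 Z1 !mul1r.
have x0 : absK (y * z) = Y y 0 * Z z 0.
  by have := absf (0, 0)%N; rewrite /f /= !expg0 !gal_id.
have Dm2 : mahler (iota (y * z)) = `|iota ((y * z) ^+ 2)|.
  by rewrite Dm -!absK_val absp absKX x0.
have Fx2 : (y * z) ^+ 2 \in F by rewrite rpredX // rpredM.
(* The sign coming from the absolute value is kept as a factor [e] of the first unit, so that the
   result is again a product of one unit for each factor. *)
have [e De Ex] : exists2 e : K, e = 1 \/ e = -1 &
    mahler (iota (y * z)) = iota (e * y ^+ 2 * z ^+ 2).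
  have [w Dw Ew] := absK_sign iota abK maxF Fx2.
  case: Dw => Dw; [exists 1; first by left | exists (-1); first by right].
    by rewrite Dm2 Ew Dw mul1r exprMn.
  by rewrite Dm2 Ew Dw mulN1r mulNr exprMn.
have absKe u : absK (e * u) = absK u by case: De => ->; rewrite ?mul1r // mulN1r absKN.
have gale (g : gal_of F) u : g (e * u) = e * g u.
  by case: De => ->; rewrite ?mul1r // !mulN1r rmorphN.
have Ue : unitF e by case: De => ->; [|apply: unitFN]; apply: unitF1.
exists (e * y ^+ 2), (z ^+ 2); split; last first.
  rewrite -Ex Dm2 normr_id; split=> //.
  change (absK (y * z) < absK ((y * z) ^+ 2)).
  by rewrite absKX x0 expr2 ltr_pMr ?mulr_gt0 ?mulr_egt1.
split.
- by apply: unitFM => //; apply: unitFX.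
- exact: unitFX.
- by move=> b Bb; rewrite gale rmorphXn /= By.
- by move=> b Bb; rewrite rmorphXn /= Bz.
move=> i /bnd[]; rewrite /Y /Z !gale !absKe !rmorphXn /= !absKX -!exprMn.
move=> yi zi yzi zyi; split.
- by rewrite exprn_ilt1 // ltW //; apply: Ypos.
- by rewrite exprn_ilt1 // ltW //; apply: Zpos.
- by rewrite exprn_egt1.
by rewrite exprn_egt1.
Qed.

Theorem three_three_wandering : exists2 u, unitF u & wandering (iota u).
Proof.
have [y [Uy By lty]] := pisot_factor iota abK maxF defGs.
have [z [Uz Bz ltz]] := pisot_factor iota abK maxF defGt.
have Ypos i : 0 < Y y i by apply: (absK_gt0 iota); rewrite fmorph_eq0; apply: unitF_neq0 Uy.
have Zpos i : 0 < Z z i by apply: (absK_gt0 iota); rewrite fmorph_eq0; apply: unitF_neq0 Uz.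
have Ylt i : (0 < i < 3)%N -> Y y i < 1.
  move=> lt_i; apply: lty; rewrite ?mem_cycle // -order_dvdn os.
  by case: i lt_i => [|[|[|]]].
have Zlt i : (0 < i < 3)%N -> Z z i < 1.
  move=> lt_i; apply: ltz; rewrite ?mem_cycle // -order_dvdn ot.
  by case: i lt_i => [|[|[|]]].
have Y1 : Y y 0 * Y y 1 * Y y 2 = 1.
  have := unitF_cycle_norm abK defGs Uy By.
  by rewrite os !big_ord_recr big_ord0 /= mul1r.
have Z1 : Z z 0 * Z z 1 * Z z 2 = 1.
  have := unitF_cycle_norm abK defGt Uz Bz.
  by rewrite ot !big_ord_recr big_ord0 /= mul1r.
have [a [a1 aY invY]] : exists a, [/\ 1 <= a, a < Y y 0 &
    forall i, (0 < i < 3)%N -> 1 <= a * Y y i].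
  exact: dominant_inverse.
have [b [b1 bZ invZ]] : exists b, [/\ 1 <= b, b < Z z 0 &
    forall i, (0 < i < 3)%N -> 1 <= b * Z z i].
  exact: dominant_inverse.
(* The exponents make the large conjugate of each unit outweigh the inverses of the small conjugates
   of the other, which are at most [a] and [b]. *)
have [p [q [p0 q0 apb bqa]]] := balance2 a1 aY b1 bZ.
pose Q alpha := exists u v, cross_pair u v /\ alpha = iota (u * v).
have Uyp := unitFX p Uy; have Uzq := unitFX q Uz.
exists (y ^+ p * z ^+ q); first exact: unitFM.
apply: (wandering_of_increasing (Q := Q)) => [|_ [u [v [uv ->]]]]; last first.
  have [u' [v' [uv' [-> lt_uv]]]] := cross_pair_mahler uv.
  by split=> //; exists u', v'.
exists (y ^+ p), (z ^+ q); split=> //; split=> // [b' Bb|b' Bb|i lt_i].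
- by rewrite rmorphXn /= By.
- by rewrite rmorphXn /= Bz.
rewrite /Y /Z !rmorphXn /= !absKX -/(Y y i) -/(Z z i) -/(Y y 0) -/(Z z 0).
split.
- by rewrite exprn_ilt1 ?Ylt ?(ltW (Ypos _)) -?lt0n.
- by rewrite exprn_ilt1 ?Zlt ?(ltW (Zpos _)) -?lt0n.
- apply: (@le_lt_trans _ _ ((a * Y y i) ^+ p)); first by rewrite exprn_ege1 ?invY.
  by rewrite exprMn mulrC ltr_pM2l ?exprn_gt0.
apply: (@le_lt_trans _ _ ((b * Z z i) ^+ q)); first by rewrite exprn_ege1 ?invZ.
by rewrite exprMn ltr_pM2r ?exprn_gt0.
Qed.

End ThreeThree.

Definition grid2 : seq (nat * nat * nat) :=
  [:: (0, 0, 0); (0, 0, 1); (0, 1, 0); (0, 1, 1);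
      (1, 0, 0); (1, 0, 1); (1, 1, 0); (1, 1, 1)]%N.

Definition majority (q : nat * nat * nat) := (odd q.1.1 + odd q.1.2 + odd q.2 <= 1)%N.

(** A finite check, used like [cross_inj] to separate conjugates. *)
Lemma majority_inj : {in grid2 &, forall q q',
  (forall i j k, majority (q.1.1 + i, q.1.2 + j, q.2 + k)%N
               = majority (q'.1.1 + i, q'.1.2 + j, q'.2 + k)%N) -> q = q'}.
Proof.
have: all (fun q => all (fun q' => (q == q') || has (fun d : nat * nat * nat =>
   majority (q.1.1 + d.1.1, q.1.2 + d.1.2, q.2 + d.2)%N
   != majority (q'.1.1 + d.1.1, q'.1.2 + d.1.2, q'.2 + d.2)%N) grid2) grid2) grid2.
  by [].
move=> /allP inj q q' /inj/allP{}inj /inj /orP[/eqP// | /hasP[[[i j] k] _ /eqP ne] eq].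
by case: ne; apply: eq.
Qed.

(** * Three factors of order two *)

Section TwoTwoTwo.

Variables (s t r : gal_of F) (Bs Bt Br : {group gal_of F}).
Hypotheses (defGs : (<[s]> \x Bs = G)%g) (defGt : (<[t]> \x Bt = G)%g).
Hypothesis defGr : (<[r]> \x Br = G)%g.
Hypotheses (os : #[s]%g = 2%N) (ot : #[t]%g = 2%N) (or : #[r]%g = 2%N).
Hypotheses (Bs_t : t \in Bs) (Bs_r : r \in Bs) (Bt_s : s \in Bt) (Bt_r : r \in Bt).
Hypotheses (Br_s : s \in Br) (Br_t : t \in Br).

Let V (g : gal_of F) x i := absK ((g ^+ i)%g x).

(** The last three inequalities concern the cells of the cube with one odd coordinate; the cells
    with more follow by passing to the opposite cell. *)
Definition majority_triple y z w :=
  [/\ [/\ unitF y, unitF z & unitF w],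
      [/\ forall b, b \in Bs -> b y = y, forall b, b \in Bt -> b z = z
        & forall b, b \in Br -> b w = w],
      [/\ 1 < V s y 0, 1 < V t z 0 & 1 < V r w 0]
    & [/\ 1 < V s y 1 * V t z 0 * V r w 0, 1 < V s y 0 * V t z 1 * V r w 0
        & 1 < V s y 0 * V t z 0 * V r w 1]].

Lemma majority_triple_mahler y z w : majority_triple y z w ->
  exists y' z' w', majority_triple y' z' w' /\
    mahler (iota (y * z * w)) = iota (y' * z' * w') /\
    `|iota (y * z * w)| < `|iota (y' * z' * w')|.
Proof.
case=> [[Uy Uz Uw] [By Bz Bw] [y0 z0 w0] [y1 z1 w1]].
have [[Fy Fz] Fw] := (unitF_F Uy, unitF_F Uz, unitF_F Uw).
pose f (q : nat * nat * nat) := (s ^+ q.1.1)%g y * (t ^+ q.1.2)%g z * (r ^+ q.2)%g w.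
have Ux := unitFM (unitFM Uy Uz) Uw.
have fixX (g : gal_of F) x i j (h : gal_of F) : x \in F -> h x = x ->
    (h ^+ j)%g ((g ^+ i)%g x) = (g ^+ i)%g x.
  move=> Fx hx; rewrite (galC abK) //; congr ((g ^+ i)%g _).
  by elim: j => [|j IHj]; rewrite ?expg0 ?gal_id // expgSr galM // IHj.
have addX (g : gal_of F) x i j : x \in F ->
    (g ^+ j)%g ((g ^+ i)%g x) = (g ^+ (i + j))%g x.
  by move=> Fx; rewrite -galM // -expgD.
have shift i j k i' j' k' :
    (r ^+ k')%g ((t ^+ j')%g ((s ^+ i')%g (f (i, j, k)))) = f (i + i', j + j', k + k')%N.
  have yt a b := fixX s y a b t Fy (By t Bs_t).
  have yr a b := fixX s y a b r Fy (By r Bs_r).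
  have zs a b := fixX t z a b s Fz (Bz s Bt_s).
  have zr a b := fixX t z a b r Fz (Bz r Bt_r).
  have ws a b := fixX r w a b s Fw (Bw s Br_s).
  have wt a b := fixX r w a b t Fw (Bw t Br_t).
  by rewrite /f !rmorphM /= zs ws !addX // yt wt yr zr addX.
have fmod i j k : f (i, j, k) = f (odd i : nat, odd j : nat, odd k : nat).
  rewrite /f /= -!modn2 -{1}os -{1}ot -{1}or.
  by rewrite !expg_mod_order.
have Vpos (g : gal_of F) x i : unitF x -> 0 < V g x i.
  by move=> U; apply: (absK_gt0 iota); rewrite fmorph_eq0; apply: unitF_neq0 U.
have yN : V s y 0 * V s y 1 = 1.
  have := unitF_cycle_norm abK defGs Uy By.
  by rewrite os !big_ord_recr big_ord0 /= mul1r.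
have zN : V t z 0 * V t z 1 = 1.
  have := unitF_cycle_norm abK defGt Uz Bz.
  by rewrite ot !big_ord_recr big_ord0 /= mul1r.
have wN : V r w 0 * V r w 1 = 1.
  have := unitF_cycle_norm abK defGr Uw Bw.
  by rewrite or !big_ord_recr big_ord0 /= mul1r.
have x0 : 1 < V s y 0 * V t z 0 * V r w 0 by rewrite !mulr_egt1.
(* Opposite cells of the cube have product 1, so a cell with at least two odd coordinates is the
   inverse of a majority cell. *)
have N8 : (V s y 0 * V s y 1) * (V t z 0 * V t z 1) * (V r w 0 * V r w 1) = 1.
  by rewrite yN zN wN !mulr1.
have c1 : V s y 0 * V t z 1 * V r w 1 < 1.
  by apply: cofactor_lt1 y1; rewrite -N8; ring.
have c2 : V s y 1 * V t z 0 * V r w 1 < 1.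
  by apply: cofactor_lt1 z1; rewrite -N8; ring.
have c3 : V s y 1 * V t z 1 * V r w 0 < 1.
  by apply: cofactor_lt1 w1; rewrite -N8; ring.
have c4 : V s y 1 * V t z 1 * V r w 1 < 1.
  by apply: cofactor_lt1 x0; rewrite -N8; ring.
have absf q : absK (f q) = V s y q.1.1 * V t z q.1.2 * V r w q.2 by rewrite /f !absKM.
have high q : (1 < absK (f q)) = majority q.
  case: q => [[i j] k]; rewrite fmod absf /majority /=.
  by case: (odd i) (odd j) (odd k) => [] [] [];
     first [by [] | by apply/negbTE; rewrite -leNgt ltW].
have uniq_f : uniq (map f grid2).
  rewrite map_inj_in_uniq // => -[[i j] k] [[i' j'] k'] g1 g2 eq_f.
  by apply: majority_inj => // a b c; rewrite -!high /= -!shift eq_f.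
have orb1 (g : gal_of F) : exists2 q, q \in grid2 & g (y * z * w) = f q.
  have [i lt_i Dy] := cycle_factor_orbit defGs os Fy By g.
  have [j lt_j Dz] := cycle_factor_orbit defGt ot Fz Bz g.
  have [k lt_k Dw] := cycle_factor_orbit defGr or Fw Bw g.
  exists (i, j, k); last by rewrite !rmorphM /= Dy Dz Dw.
  by case: i j k lt_i lt_j lt_k {Dy Dz Dw} => [|[|//]] [|[|//]] [|[|//]].
have Fx : y * z * w \in F by apply: unitF_F Ux.
have orb2 q : exists g : gal_of F, f q = g (y * z * w).
  case: q => [[i j] k]; exists (s ^+ i * t ^+ j * r ^+ k)%g.
  have := shift 0%N 0%N 0%N i j k; rewrite !add0n => <-.
  by rewrite !galM // /f /= !expg0 !gal_id.
have := mahler_indexed Ux orb1 orb2 uniq_f high.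
set p := \prod_(q <- _ | _) _ => Dm.
set X := V s y 0 * V t z 0 * V r w 0 in x0.
(* Over the four majority cells each factor contributes its value at 0 three times and its value at
   1 once. *)
have absp : absK p = X ^+ 2.
  rewrite absK_prod (eq_bigr _ (fun q _ => absf q)) /grid2 !big_cons big_nil /=.
  transitivity ((V s y 0 * V s y 1) * (V t z 0 * V t z 1) * (V r w 0 * V r w 1) * X ^+ 2).
    by rewrite /X; ring.
  by rewrite N8 mul1r.
have DX : absK (y * z * w) = X.
  by have := absf (0, 0, 0)%N; rewrite /f /= !expg0 !gal_id.
have Dm2 : mahler (iota (y * z * w)) = `|iota ((y * z * w) ^+ 2)|.
  by rewrite Dm -!absK_val absp absKX DX.
have [e De Ex] : exists2 e : K, e = 1 \/ e = -1 &
    mahler (iota (y * z * w)) = iota (e * y ^+ 2 * z ^+ 2 * w ^+ 2).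
  have [x Dx Ew] := absK_sign iota abK maxF (rpredX 2 Fx).
  case: Dx => Dx; [exists 1; first by left | exists (-1); first by right].
    by rewrite Dm2 Ew Dx mul1r !exprMn.
  by rewrite Dm2 Ew Dx mulN1r !mulNr !exprMn.
have absKe u : absK (e * u) = absK u by case: De => ->; rewrite ?mul1r // mulN1r absKN.
have gale (g : gal_of F) u : g (e * u) = e * g u.
  by case: De => ->; rewrite ?mul1r // !mulN1r rmorphN.
have Ue : unitF e by case: De => ->; [|apply: unitFN]; apply: unitF1.
exists (e * y ^+ 2), (z ^+ 2), (w ^+ 2); split; last first.
  rewrite -Ex Dm2 normr_id; split=> //.
  change (absK (y * z * w) < absK ((y * z * w) ^+ 2)).
  by rewrite absKX DX expr2 ltr_pMr // (lt_trans ltr01).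
split.
- by split; do ?apply: unitFM => //; apply: unitFX.
- by split=> b Bb; rewrite ?gale rmorphXn /= ?(By _ Bb) ?(Bz _ Bb) ?(Bw _ Bb).
- by rewrite /V !gale !absKe !rmorphXn /= !absKX; split; apply: exprn_egt1.
by rewrite /V !gale !absKe !rmorphXn /= !absKX -!exprMn; split; apply: exprn_egt1.
Qed.

Theorem two_two_two_wandering : exists2 u, unitF u & wandering (iota u).
Proof.
have [y [Uy By lty]] := pisot_factor iota abK maxF defGs.
have [z [Uz Bz ltz]] := pisot_factor iota abK maxF defGt.
have [w [Uw Bw ltw]] := pisot_factor iota abK maxF defGr.
have inv (g : gal_of F) (B : {group gal_of F}) x : (<[g]> \x B = G)%g -> #[g]%g = 2%N ->
    unitF x -> (forall b, b \in B -> b x = x) ->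
    (forall a, a \in <[g]>%g -> a != 1%g -> absK (a x) < 1) ->
  [/\ 1 < V g x 0, 0 < V g x 1 & V g x 0 * V g x 1 = 1].
  move=> defG og Ux Bx lt1.
  have N1 : V g x 0 * V g x 1 = 1.
    have := unitF_cycle_norm abK defG Ux Bx.
    by rewrite og !big_ord_recr big_ord0 /= mul1r.
  have V0 : 0 < V g x 1.
    by apply: (absK_gt0 iota); rewrite fmorph_eq0; apply: unitF_neq0 Ux.
  split=> //; apply: (cofactor_gt1 N1); rewrite V0 lt1 ?mem_cycle //.
  by rewrite expg1 -order_gt1 og.
have [y0 y1 yN] := inv s Bs y defGs os Uy By lty.
have [z0 z1 zN] := inv t Bt z defGt ot Uz Bz ltz.
have [w0 w1 wN] := inv r Br w defGr or Uw Bw ltw.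
(* Each small conjugate is the inverse of the large one, so the triangle inequalities of [balance3]
   are the inequalities for the cells with one odd coordinate. *)
have [p [q [m [[p_gt0 [q_gt0 m_gt0]] lt_p lt_q lt_m]]]] := balance3 y0 z0 w0.
pose Q alpha := exists a b c, majority_triple a b c /\ alpha = iota (a * b * c).
have Uyp := unitFX p Uy; have Uzq := unitFX q Uz; have Uwm := unitFX m Uw.
exists (y ^+ p * z ^+ q * w ^+ m); first by do 2!apply: unitFM => //.
apply: (wandering_of_increasing (Q := Q)) => [|_ [a [b [c [abc ->]]]]]; last first.
  have [a' [b' [c' [abc' [-> lt_abc]]]]] := majority_triple_mahler abc.
  by split=> //; exists a', b', c'.
have scale u v n : 0 < u -> u ^+ n < v -> forall u', u * u' = 1 -> 1 < u' ^+ n * v :> algR.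
  move=> u0 lt_uv u' uu'; have -> : u' = u^-1.
    by apply: (mulfI (lt0r_neq0 u0)); rewrite uu' divff ?lt0r_neq0.
  by rewrite exprVn mulrC ltr_pdivlMr ?mul1r ?exprn_gt0.
have pos x : 1 < x -> 0 < x :> algR by apply: lt_trans.
exists (y ^+ p), (z ^+ q), (w ^+ m); split=> //; split=> //.
- by split=> b Bb; rewrite rmorphXn /= ?(By _ Bb) ?(Bz _ Bb) ?(Bw _ Bb).
- by rewrite /V !rmorphXn /= !absKX; split; rewrite exprn_egt1 // -lt0n.
rewrite /V !rmorphXn /= !absKX; split.
- rewrite -mulrA; exact: (scale _ _ _ (pos _ y0) lt_p).
- rewrite -mulrA mulrCA; exact: (scale _ _ _ (pos _ z0) lt_q).
rewrite mulrC; exact: (scale _ _ _ (pos _ w0) lt_m).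
Qed.

End TwoTwoTwo.

End SquareOrbits.

(** * Preperiodic points *)

Lemma preperiodic_mahler alpha : preperiodic (mahler alpha) -> preperiodic alpha.
Proof.
case=> s in_s; exists (alpha :: s) => -[|n]; first exact: mem_head.
by rewrite iterSr inE in_s orbT.
Qed.

Lemma preperiodic_iter n alpha : preperiodic (iter n mahler alpha) -> preperiodic alpha.
Proof.
by elim: n => // n IHn; rewrite iterS => prepM; apply/IHn/preperiodic_mahler.
Qed.

Section Preperiodic.

Variables (K : splittingFieldType rat) (iota : {rmorphism K -> algC}).
Hypothesis abK : abelian_number_field K.
Variable F : {subfield K}.
Hypothesis maxF : maximal_totally_real F.

Local Notation G := ('Gal(F / 1%AS)%g).
Local Notation absK := (absK iota).

(** 0 and 1 are sent to 1, and every k >= 2 is its own Mahler measure. *)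
Lemma preperiodic_nat m : preperiodic (m%:R).
Proof.
have mahler_nat k : mahler (k%:R) = if (1 < k)%N then k%:R else 1.
  have DR : [:: k%:R] =i [seq g (k%:R : K) | g : gal_of F in G].
    move=> z; rewrite inE; apply/eqP/imageP => [-> | [g _ ->]].
      by exists 1%g; rewrite ?gal1F ?gal_id.
    by rewrite rmorph_nat.
  have Zk : iota k%:R \in Aint by rewrite rmorph_nat Aint_Cnat ?natr_nat.
  have := mahler_conjugates abK (rpred_nat F k) Zk (isT : uniq [:: k%:R]) DR.
  rewrite rmorph_nat => ->.
  rewrite big_cons big_nil /=.
  have -> : (1 < absK k%:R) = (1 < k)%N.
    change ((1 < `|iota k%:R|) = (1 < k)%N).
    by rewrite rmorph_nat normr_nat ltr1n.
  by case: ifP; rewrite ?mulr1 ?rmorph_nat ?normr_nat // rmorph1 normr1.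
exists [:: m%:R; 1] => n; elim: n => [|n]; first exact: mem_head.
rewrite iterS !inE => /orP[] /eqP->; first rewrite mahler_nat.
  by case: ifP => _; rewrite ?eqxx ?orbT.
by rewrite (mahler_nat 1%N) eqxx orbT.
Qed.

(** One step of M reduces the problem to nonzero integers of F: the roots outside the unit circle
    are closed under conjugation, and [Aint_lead_prod_roots] gives integrality even when [x] is not
    integral. *)
Lemma mahler_real_subfield (x : K) :
  exists y, [/\ mahler (iota x) = iota y, y \in F, iota y \in Aint & y != 0].
Proof.
have [galK _] := abK.
set R := undup [seq g x | g : gal_of {:K} in 'Gal({:K} / 1%AS)%g].
have UR : uniq R by apply: undup_uniq.
have DR : R =i [seq g x | g : gal_of {:K} in 'Gal({:K} / 1%AS)%g] by apply: mem_undup.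
have Dp := minCpoly_conjugates iota galK (memvf x) UR DR.
rewrite (mahlerE Dp) prod_max1; set a := lead_coef _.
have nz_a : a != 0 by apply: lead_minZpoly_neq0.
pose p := \prod_(z <- R | 1 < `|iota z|) z.
have Dip : \prod_(z <- map iota R | 1 < `|z|) z = iota p by rewrite big_map rmorph_prod.
have Rp : iota p \is Num.real.
  rewrite -Dip; apply: prod_roots_real => [|z|z]; last by rewrite norm_conjC.
    by rewrite map_inj_uniq //; apply: fmorph_inj.
  rewrite -!root_prod_XsubC -Dp; exact: conj_root_minCpoly.
have Zap : iota (a%:~R * p) \in Aint.
  rewrite rmorphM rmorph_int -Dip; apply: Aint_lead_prod_roots.
  rewrite -Dp -lead_minZpoly; apply/polyOverP=> i; rewrite coef_map; exact: Aint_int.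
have Fap : a%:~R * p \in F.
  by rewrite (mem_maximal_totally_real iota abK maxF) rmorphM rmorph_int realM ?realz.
have nz_ap : a%:~R * p != 0.
  rewrite mulf_neq0 //; last first.
    rewrite prodf_seq_neq0; apply/allP => z _; apply/implyP => z1.
    by apply: contraTneq z1 => ->; rewrite rmorph0 normr0 ltr10.
  by rewrite -(fmorph_eq0 iota) rmorph_int intr_eq0.
have [y Dy Ey] := absK_sign iota abK maxF Fap.
exists y; split.
- by rewrite Dip -Ey rmorphM rmorph_int normrM.
- by case: Dy => ->; rewrite ?rpredN.
- by case: Dy => ->; rewrite ?rmorphN ?rpredN.
by case: Dy => ->; rewrite ?oppr_eq0.
Qed.

(** Choosing one automorphism for each distinct conjugate lets the translates of a subset of the
    group be followed below. *)
Lemma mahler_gal_seq (y : K) : y \in F -> iota y \in Aint ->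
  exists2 r : seq (gal_of F), uniq [seq g y | g : gal_of F <- r] &
    [seq g y | g : gal_of F <- r] =i [seq g y | g : gal_of F in G] /\
    mahler (iota y) = `|iota (\prod_(g <- r | 1 < absK (g y)) g y)|.
Proof.
move=> Fy Zy; have galF := galois_subfield abK F.
have [r [sr Ur Dr]] := galois_factors (sub1v F) galF y Fy.
have DR : [seq g y | g : gal_of F <- r] =i [seq g y | g : gal_of F in G].
  have nF : normalField 1 F by case/and3P: galF.
  move=> z; rewrite -root_prod_XsubC -Dr; apply/idP/imageP => [p0 | [g Gg ->]].
    by have [g Gg <-] := normalField_root_minPoly (sub1v F) nF Fy p0; exists g.
  by apply: root_minPoly_gal; rewrite ?sub1v.
exists r => //; split=> //.
by rewrite (mahler_conjugates abK Fy Zy Ur DR) big_map.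
Qed.

(** * Orbits of integers for the groups in the list *)

Section SmallGroup.

Hypothesis smallG : (#|{: gal_of F}| <= 3)%N \/
  #|{: gal_of F}| = 4%N /\ (forall g : gal_of F, g * g = 1)%g.

Variable x : K.
Hypotheses (Fx : x \in F) (Zx : iota x \in Aint) (nz_x : x != 0).

Definition subnorm (S : {set gal_of F}) := \prod_(g in S) g x.

Lemma subnorm_gal (S : {set gal_of F}) (g : gal_of F) : g (subnorm S) = subnorm (S :* g)%g.
Proof.
rewrite /subnorm rmorph_prod /= [RHS](reindex_inj (mulIg g)) /=.
apply: eq_big => [h | h _]; first by rewrite mem_rcoset mulgK.
by rewrite galM.
Qed.

Let N := subnorm setT.

Lemma absK_subnormT : exists2 k, (0 < k)%N & absK N = k%:R.
Proof.
have [k k0 Dk] := gal_norm_nat abK Fx Zx nz_x; exists k; rewrite // -Dk.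
by rewrite /N /subnorm absK_prod; apply: eq_bigl => g; rewrite inE.
Qed.

Let absS (S : {set gal_of F}) := absK (subnorm S).

Lemma absS_gt0 S : 0 < absS S.
Proof.
apply: (absK_gt0 iota); rewrite prodf_seq_neq0; apply/allP=> g _.
by apply/implyP; rewrite fmorph_eq0.
Qed.

Lemma absSC S : absS S * absS (~: S) = absK N.
Proof.
rewrite -absKM; congr absK; rewrite /N /subnorm [RHS](bigID (mem S)) /=.
by congr (_ * _); apply: eq_bigl => g; rewrite !inE.
Qed.

Lemma absS0 : absS set0 = 1.
Proof. by rewrite /absS /subnorm big_set0 absK1. Qed.

Lemma absS_rcosetC (S : {set gal_of F}) g : absS (S :* g)%g * absS (~: S :* g)%g = absK N.
Proof.
rewrite -(absSC (S :* g)%g); congr (_ * absS _).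
by apply/setP=> h; rewrite !(inE, mem_rcoset).
Qed.

(** Distinct translates of a point are distinct points, so their product is again taken over a
    set. *)
Lemma prod_absS1 s (r : seq (gal_of F)) : uniq [seq ([set s] :* g)%g | g <- r] ->
  \prod_(g <- r) absS ([set s] :* g)%g = absS [set (s * g)%g | g in r].
Proof.
move=> Ur; have Us : uniq r by apply: map_uniq Ur.
rewrite /absS /subnorm absK_prod big_imset /=; last by move=> g h _ _; apply: mulgI.
rewrite big_uniq //; apply: eq_bigr => g _.
by rewrite mulg_set1 big_set1.
Qed.

Lemma prod_absSC (S : {set gal_of F}) (r : seq (gal_of F)) :
  \prod_(g <- r) absS (S :* g)%g * \prod_(g <- r) absS (~: S :* g)%g = absK N ^+ size r.
Proof.
rewrite -big_split /=; under eq_bigr do rewrite absS_rcosetC.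
by elim: r => [|g r IHr]; rewrite ?big_nil // big_cons IHr exprS.
Qed.

(** For S = {a, b} every translate has the form {z, z(ab)}, so translates that meet coincide;
    distinct ones are disjoint and, having two elements each, complementary. *)
Lemma rcoset2_partition (S : {set gal_of F}) g h :
    #|{: gal_of F}| = 4%N -> (forall g : gal_of F, g * g = 1)%g -> #|S| = 2%N ->
  (S :* g != S :* h)%g -> (S :* h = ~: (S :* g))%g.
Proof.
move=> n4 sq1 /eqP/cards2P[a [b [ne_ab DS]]] ne_gh.
have cGG (u v : gal_of F) : (u * v = v * u)%g.
  exact: (centsP (abelian_Gal_subfield abK F) _ (gal1F u) _ (gal1F v)).
have inv1 (u : gal_of F) : (u^-1 = u)%g by apply/eqP; rewrite eq_invg_mul sq1.
have coset2 k z : z \in (S :* k)%g -> (S :* k = [set z; z * (a * b)])%g.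
  have -> : (S :* k = [set a * k; b * k])%g.
    by apply/setP=> w; rewrite mem_rcoset DS !inE !(can2_eq (mulgKV k) (mulgK k)).
  have ak : (a * k * (a * b) = b * k)%g.
    by rewrite [(a * k)%g]cGG -mulgA [(a * (a * b))%g]mulgA sq1 mul1g cGG.
  have bk : (b * k * (a * b) = a * k)%g.
    by rewrite [(a * b)%g]cGG [(b * k)%g]cGG -mulgA [(b * (b * a))%g]mulgA sq1 mul1g cGG.
  by rewrite !inE => /orP[]/eqP->; rewrite ?ak ?bk // setUC.
have cSg k : #|(S :* k)%g| = 2%N by rewrite card_rcoset DS cards2 ne_ab.
apply/eqP; rewrite eqEcard; apply/andP; split; last first.
  by have := cardsC (S :* g)%g; rewrite !cSg n4; lia.
apply/subsetP=> z hz; rewrite inE; apply: contra ne_gh => gz.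
by rewrite (coset2 _ _ gz) (coset2 _ _ hz).
Qed.

(** If [S] or its complement has at most one element, everything reduces to translates of a point,
    powers of the full norm going into [m]. Otherwise the group has order 4 and exponent 2, and two
    distinct translates multiply to the full norm. *)
Lemma subnorm_translates (S : {set gal_of F}) (r : seq (gal_of F)) :
    uniq [seq (S :* g)%g | g <- r] ->
  exists m T, (0 < m)%N /\ \prod_(g <- r) absS (S :* g)%g = m%:R * absS T.
Proof.
move=> Ur; have [k k_gt0 Dk] := absK_subnormT.
have kX n : (0 < k ^ n)%N by rewrite expn_gt0 k_gt0.
have [S0 | nS0] := eqVneq #|S| 0%N.
  exists 1%N, set0; split=> //; rewrite absS0 mulr1 big1 // => g _.
  by move/eqP: S0; rewrite cards_eq0 => /eqP->; rewrite mul0g absS0.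
have [/eqP/cards1P[s Ds] | nS1] := eqVneq #|S| 1%N.
  exists 1%N, [set (s * g)%g | g in r]; split=> //.
  by rewrite Ds mul1r in Ur *; rewrite prod_absS1.
have cS : (#|S| + #|~: S| = #|{: gal_of F}|)%N := cardsC S.
have [C0 | nC0] := eqVneq #|~: S| 0%N.
  exists (k ^ size r)%N, set0; split=> //; rewrite absS0 mulr1 natrX -Dk.
  rewrite -(prod_absSC S r) [X in _ = _ * X]big1 ?mulr1 // => g _.
  by move/eqP: C0; rewrite cards_eq0 => /eqP->; rewrite mul0g absS0.
have [/eqP/cards1P[s Ds] | nC1] := eqVneq #|~: S| 1%N.
  have UrC : uniq [seq ([set s] :* g)%g | g <- r].
    have := Ur; rewrite -(map_inj_uniq (@setC_inj _)) -map_comp.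
    congr (uniq _); apply: eq_map => g /=; rewrite -Ds.
    by apply/setP=> h; rewrite !(inE, mem_rcoset).
  (* The complements multiply to [absS T], so the translates of [S] give [absK N ^+ size r] divided
     by it; one factor [absK N] turns the quotient into [absS (~: T)]. *)
  set T := [set (s * g)%g | g in r].
  have E : \prod_(g <- r) absS (S :* g)%g * absS T = absK N ^+ size r.
    by rewrite -(prod_absSC S r) Ds prod_absS1.
  case: r {Ur UrC} @T E => [|g r] T E.
    by exists 1%N, set0; split=> //; rewrite big_nil absS0 mulr1.
  exists (k ^ size r)%N, (~: T); split=> //.
  apply: (mulIf (lt0r_neq0 (absS_gt0 T))); rewrite E natrX -Dk -mulrA.
  by rewrite [absS (~: T) * _]mulrC absSC -exprSr.
have [n4 g2] : #|{: gal_of F}| = 4%N /\ (forall g : gal_of F, g * g = 1)%g.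
  by case: smallG => // le3; lia.
have c2 : #|S| = 2%N by lia.
(* There are at most two distinct translates: a third would, like the second, be the complement of
   the first. *)
case: r Ur => [|g1 [|g2' [|g3 r]]] Ur.
- by exists 1%N, set0; split=> //; rewrite big_nil absS0 mulr1.
- by exists 1%N, (S :* g1)%g; split=> //; rewrite big_cons big_nil mulr1 mul1r.
- exists k, set0; split=> //; rewrite !big_cons big_nil mulr1 absS0 mulr1 -Dk.
  have ne : (S :* g1 != S :* g2')%g by move: Ur; rewrite /= inE andbT.
  by rewrite (rcoset2_partition n4 g2 c2 ne) absSC.
have [ne12 ne13 ne23] :
    [/\ S :* g1 != S :* g2', S :* g1 != S :* g3 & S :* g2' != S :* g3]%g.
  by move: Ur; rewrite /= !inE !negb_or => /and3P[/and3P[-> -> _] /andP[-> _] _].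
case/eqP: ne23.
by rewrite (rcoset2_partition n4 g2 c2 ne12) (rcoset2_partition n4 g2 c2 ne13).
Qed.
Definition subnorm_multiple alpha e m S :=
  [/\ e = 1 \/ e = -1, (0 < m)%N & alpha = iota (e * (m%:R * subnorm S))].

Lemma subnorm_F S : subnorm S \in F.
Proof. by apply: rpred_prod => g _; apply: memv_gal. Qed.

Lemma subnorm_Aint S : iota (subnorm S) \in Aint.
Proof. by rewrite rmorph_prod rpred_prod // => g _; apply: Aint_gal. Qed.

Lemma absK_nat m : absK m%:R = m%:R.
Proof. by apply: val_inj; rewrite /= rmorph_nat normr_nat rmorph_nat. Qed.

Lemma subnorm_multiple_F e m S : e = 1 \/ e = -1 -> e * (m%:R * subnorm S) \in F.
Proof.
by move=> De; case: De => ->; rewrite ?mul1r ?mulN1r ?rpredN rpredM ?rpred_nat ?subnorm_F.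
Qed.

Lemma subnorm_multiple_Aint e m S : e = 1 \/ e = -1 ->
  iota (e * (m%:R * subnorm S)) \in Aint.
Proof.
move=> De; have Zm : iota (m%:R * subnorm S) \in Aint.
  by rewrite rmorphM rmorph_nat rpredM ?subnorm_Aint // Aint_Cnat ?natr_nat.
by case: De => ->; rewrite ?mul1r // mulN1r rmorphN rpredN.
Qed.

Lemma absK_multiple e m S : e = 1 \/ e = -1 ->
  absK (e * (m%:R * subnorm S)) = m%:R * absS S.
Proof. by case=> ->; rewrite ?mul1r ?mulN1r ?absKN absKM absK_nat. Qed.

Lemma gal_multiple e m S (g : gal_of F) : e = 1 \/ e = -1 ->
  g (e * (m%:R * subnorm S)) = e * (m%:R * subnorm (S :* g)%g).
Proof.
by case=> ->; rewrite ?mul1r ?mulN1r ?rmorphN rmorphM rmorph_nat /= subnorm_gal.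
Qed.

Lemma subnorm_multiple_mahler alpha e m S : subnorm_multiple alpha e m S ->
  exists e' m' S', subnorm_multiple (mahler alpha) e' m' S'.
Proof.
case=> De m_gt0 ->; set y := e * _.
have [|r Ur [_ ->]] := mahler_gal_seq _ (subnorm_multiple_Aint m S De).
  exact: subnorm_multiple_F.
rewrite -/y in Ur *; rewrite -big_filter; set r' := filter _ r.
(* The translates of [S] determine the conjugates of [y], so distinct conjugates come from distinct
   translates. *)
have Ur' : uniq [seq (S :* g)%g | g <- r'].
  have : uniq [seq g y | g : gal_of F <- r'].
    by apply: subseq_uniq Ur; apply/map_subseq/filter_subseq.
  have -> : [seq g y | g : gal_of F <- r'] =
      [seq e * (m%:R * subnorm T) | T : {set gal_of F} <- [seq (S :* g)%g | g <- r']].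
    by rewrite -map_comp; apply: eq_map => g; rewrite /= gal_multiple.
  exact: map_uniq.
have [k [T [k_gt0 Dk]]] := subnorm_translates Ur'.
set p := \prod_(g <- r') g y; pose z := (m ^ size r' * k)%:R * subnorm T.
have absp : absK p = absK z.
  rewrite /p absK_prod /z absKM absK_nat natrM -mulrA -Dk.
  under eq_bigr do rewrite gal_multiple // absK_multiple //.
  rewrite big_split /=; congr (_ * _).
  by elim: (r') => [|g s IHs]; rewrite ?big_nil // big_cons IHs -natrM -expnS.
have Fz : z \in F by rewrite rpredM ?rpred_nat ?subnorm_F.
have [w Dw Ew] := absK_sign iota abK maxF Fz.
rewrite -absK_val absp absK_val Ew.
have mk_gt0 : (0 < m ^ size r' * k)%N by rewrite muln_gt0 expn_gt0 m_gt0.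
case: Dw => ->; [exists 1 | exists (-1)]; exists (m ^ size r' * k)%N, T.
  by split; [left | | rewrite mul1r].
by split; [right | | rewrite mulN1r].
Qed.

(** The product then runs over the whole Galois orbit, so it is a rational integer. *)
Lemma mahler_all_large y : y \in F -> iota y \in Aint ->
  (forall g : gal_of F, 1 < absK (g y)) -> exists m, mahler (iota y) = m%:R.
Proof.
move=> Fy Zy y1; have [r Ur [DR ->]] := mahler_gal_seq Fy Zy.
rewrite (eq_bigl xpredT) => [|g]; last exact: y1.
set p := \prod_(g <- r) g y.
have Fp : p \in F by apply: rpred_prod => g _; apply: memv_gal.
have Zp : iota p \in Aint by rewrite rmorph_prod rpred_prod // => g _; apply: Aint_gal.
have fix_p (h : gal_of F) : h p = p.
  rewrite /p rmorph_prod /= -(big_map (fun g : gal_of F => g y) xpredT h) /=.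
  rewrite -[RHS](big_map (fun g : gal_of F => g y) xpredT id) -(big_map h xpredT id).
  apply: perm_big; apply: uniq_perm => [||z] //.
    by rewrite map_inj_uniq //; apply: fmorph_inj.
  rewrite DR; apply/mapP/imageP => [[w + ->] | [g _ ->]].
    by rewrite DR => /imageP[g _ ->]; exists (g * h)%g; rewrite ?gal1F // galM.
  exists ((g * h^-1)%g y).
    by rewrite DR; apply/imageP; exists (g * h^-1)%g; rewrite ?gal1F.
  by rewrite -galM // mulgKV.
have /intrP[k Dk] := Cint_rat_Aint (fixed_rat iota abK Fp fix_p) Zp.
by exists `|k|%N; rewrite Dk -intr_norm -abszE.
Qed.

(** A dichotomy on the multiplier. Once it reaches [b], all conjugates of that term exceed 1 and the
    next term is a natural number; if it never does, the orbit lies in the finite list [L]. *)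
Lemma preperiodic_multiple alpha e m S :
  subnorm_multiple alpha e m S -> preperiodic alpha.
Proof.
move=> alpha_m.
have [b Db] : exists b : nat, forall T, 1 < b%:R * absS T.
  have /fin_all_exists[b Hb] : forall T, exists b : nat, 1 < b%:R * absS T.
    move=> T; exists (Num.bound (absS T)^-1).
    rewrite -ltr_pdivrMr ?absS_gt0 // div1r archi_boundP // invr_ge0.
    exact/ltW/absS_gt0.
  exists (\max_T b T) => T; apply: lt_le_trans (Hb T) _.
  by rewrite ler_pM2r ?absS_gt0 // ler_nat (leq_bigmax (F := b)).
have orbit n : exists e' m' S', subnorm_multiple (iter n mahler alpha) e' m' S'.
  elim: n => [|n [e' [m' [S' /subnorm_multiple_mahler]]]] //.
  by exists e, m, S.
have [[n [e' [m' [S' [le_bm [De' m'_gt0 Dn]]]]]] | small] := classic (exists n e' m' S',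
    (b <= m')%N /\ subnorm_multiple (iter n mahler alpha) e' m' S').
  have [k Dk] : exists k, mahler (iter n mahler alpha) = k%:R.
    rewrite Dn; apply: mahler_all_large => [||g].
    - exact: subnorm_multiple_F.
    - exact: subnorm_multiple_Aint.
    rewrite gal_multiple // absK_multiple //; apply: lt_le_trans (Db (S' :* g)%g) _.
    by rewrite ler_pM2r ?absS_gt0 // ler_nat.
  by apply: (@preperiodic_iter n.+1); rewrite iterS Dk; apply: preperiodic_nat.
pose L := [seq iota (q.1 * (q.2.1%:R * subnorm q.2.2)) | q <-
  [seq (d, u) | d <- [:: 1; -1], u <-
  [seq (k, T) | k <- seq.iota 0 b, T <- enum {set gal_of F}]]].
exists L => n; have [e' [m' [S' nm]]] := orbit n.
have [De' _ ->] := nm.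
apply/mapP; exists (e', (m', S')) => //.
apply: allpairs_f; first by rewrite !inE; case: De' => ->; rewrite eqxx ?orbT.
apply: allpairs_f; last by rewrite mem_enum.
rewrite mem_iota add0n ltnNge /=; apply/negP=> le_bm.
by apply: small; exists n, e', m', S'.
Qed.

Lemma preperiodic_Aint : preperiodic (iota x).
Proof.
apply: (@preperiodic_multiple _ 1 1%N [set 1%g]); split=> //; first by left.
by rewrite /subnorm big_set1 gal_id !mul1r.
Qed.

End SmallGroup.

Theorem preperiodic_small_group (x : K) :
    (#|{: gal_of F}| <= 3)%N \/
    #|{: gal_of F}| = 4%N /\ (forall g : gal_of F, g * g = 1)%g ->
  preperiodic (iota x).
Proof.
move=> smallG; apply: preperiodic_mahler.
by have [y [-> Fy Zy nz_y]] := mahler_real_subfield x; apply: preperiodic_Aint.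
Qed.

End Preperiodic.

(** * Abelian groups outside the list *)

Section AbelianClassification.

Variables (gT : finGroupType) (G : {group gT}).

Lemma dprod_right_group (A H : {set gT}) : (A \x H = G)%g -> exists B : {group gT}, H = B.
Proof. by case/dprodP=> -[_ B _ ->] _ _ _; exists B. Qed.

Lemma dprodCA (A B C : {set gT}) : (A \x (B \x C) = B \x (A \x C))%g.
Proof. by rewrite !dprodA (dprodC A B). Qed.

Lemma mem_dprod_left t (R : {set gT}) (B : {group gT}) : (<[t]> \x R = B)%g -> t \in B.
Proof.
case/dprodP=> -[_ R' _ ->] <- _ _.
by rewrite (subsetP (mulG_subl R' _)) // cycle_id.
Qed.

(** Each generator has its own complement, containing the other generators: a unit fixed by that
    complement is moved by one generator only. *)
Definition wandering_shape :=
  [\/ exists t (B : {group gT}), (<[t]> \x B = G)%g /\ (3 < #[t]%g)%N,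
      exists s t (Bs Bt : {group gT}),
        [/\ (<[s]> \x Bs = G)%g, (<[t]> \x Bt = G)%g, #[s]%g = 3%N, #[t]%g = 3%N
          & t \in Bs /\ s \in Bt]
    | exists s t r (Bs Bt Br : {group gT}),
        [/\ [/\ <[s]> \x Bs = G, <[t]> \x Bt = G & <[r]> \x Br = G]%g,
            [/\ #[s]%g = 2%N, #[t]%g = 2%N & #[r]%g = 2%N]
          & [/\ t \in Bs /\ r \in Bs, s \in Bt /\ r \in Bt & s \in Br /\ t \in Br]]].

Lemma isog_C2xC2 : (2.-abelem G)%g -> #|G| = 4%N -> G \isog setX (Zp 2) (Zp 2).
Proof.
move=> abG oG; rewrite (isog_abelem_card _ abG) cardsX card_Zp // oG eqxx andbT.
rewrite abelemE //; apply/andP; split.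
  by apply/centsP=> -[a b] _ [c d] _; congr (_, _); apply: Zp_mulgC.
by apply/exponentP=> -[[[|[|//]] ?] [[|[|//]] ?]] _; apply/eqP.
Qed.

(** In the invariant factor decomposition each order divides the preceding one. If the first is at
    most 3 it is prime, so the second equals it, and for order 2 so does the third; only the number
    of factors remains to be examined. *)
Lemma abelian_classification :
  abelian G -> isog_C1_C2_C3_C2xC2 G \/ wandering_shape.
Proof.
move=> abG; have [b defG tG] := abelian_structure abG.
have := abelian_type_dvdn_sorted G; have := abelian_type_gt1 G; rewrite -{}tG.
have isog_cyc x n : <[x]>%g = G -> (0 < n)%N -> #[x]%g = n -> G \isog Zp n.
  move=> Dx n0 ox; have cycZ : cyclic (Zp n).
    by rewrite /Zp; case: (1 < n)%N; [rewrite Zp_cycle cycle_cyclic | apply: cyclic1].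
  by rewrite -Dx isog_cyclic_card ?cycle_cyclic //= cycZ card_Zp // -ox orderE eqxx.
case: b defG => [|x b]; rewrite ?big_nil ?big_cons.
  by move=> G1 _ _; left; apply: Or41; apply: (isog_cyc 1%g); rewrite ?cycle1 ?order1.
move=> defG /= /andP[x1 b1] sorted_b.
have [x3 | ] := ltnP 3 #[x]%g.
  have [B DB] := dprod_right_group defG.
  by right; apply: Or31; exists x, B; rewrite -DB.
move=> x3; case: b defG b1 sorted_b => [|y b].
  rewrite big_nil dprodg1 => defG _ _; left.
  have [o2 | o3] : #[x]%g = 2%N \/ #[x]%g = 3%N by lia.
    by apply: Or42; apply: isog_cyc o2.
  by apply: Or43; apply: isog_cyc o3.
rewrite big_cons /= => defG /andP[y1 b1] /andP[yx sorted_b].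
have prime_x : prime #[x]%g by case: (#[x]%g) x1 x3 => [|[|[|[|]]]].
have Dy : #[y]%g = #[x]%g.
  case/primeP: prime_x => _ /(_ _ yx) /orP[/eqP oy | /eqP//].
  by rewrite oy in y1.
have defGy : (<[y]> \x (<[x]> \x \big[dprod/1]_(j <- b) <[j]>) = G)%g by rewrite dprodCA.
have [Bx DBx] := dprod_right_group defG; have [By DBy] := dprod_right_group defGy.
have Bx_y := mem_dprod_left DBx; have By_x := mem_dprod_left DBy.
have [o2 | o3] : #[x]%g = 2%N \/ #[x]%g = 3%N by lia.
  case: b defG defGy DBx DBy b1 sorted_b => [|z b].
    rewrite big_nil !dprodg1 => defG _ _ _ _ _; left; apply: Or44.
    apply: isog_C2xC2; last by rewrite -(dprod_card defG) -!orderE Dy o2.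
    have abel2 (u : gT) : #[u]%g = 2%N -> (2.-abelem <[u]>)%g.
      by move=> ou; rewrite cycle_abelem ?ou ?orbT.
    by rewrite (dprod_abelem _ defG) !abel2 // Dy.
  rewrite big_cons /= => defG defGy DBx DBy /andP[z1 _] /andP[zy _]; right.
  have oz : #[z]%g = 2%N.
    by rewrite Dy o2 in zy; have := dvdn_leq (isT : 0 < 2)%N zy; lia.
  have defGz : (<[z]> \x (<[x]> \x (<[y]> \x \big[dprod/1]_(j <- b) <[j]>)) = G)%g.
    by rewrite dprodCA [(<[z]> \x _)%g]dprodCA.
  have [Bz DBz] := dprod_right_group defGz.
  apply: Or33; exists x, y, z, Bx, By, Bz.
  have Bx_z := mem_dprod_left (etrans (dprodCA _ _ _) DBx).
  have By_z := mem_dprod_left (etrans (dprodCA _ _ _) DBy).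
  have Bz_x := mem_dprod_left DBz.
  have Bz_y := mem_dprod_left (etrans (dprodCA _ _ _) DBz).
  by split; [rewrite -DBx -DBy -DBz | rewrite Dy |].
right; apply: Or32; exists x, y, Bx, By.
by split; rewrite -?DBx -?DBy ?Dy //; rewrite ?DBx ?DBy.
Qed.

Lemma isog_C1_C2_C3_C2xC2_small : isog_C1_C2_C3_C2xC2 G ->
  (#|G| <= 3)%N \/ #|G| = 4%N /\ (forall g, g \in G -> g * g = 1)%g.
Proof.
case=> isoG; [left | left | left | right]; rewrite ?(card_isog isoG) ?card_Zp //.
rewrite cardsX card_Zp; split=> // g Gg.
have exp2 : (exponent G %| 2)%N.
  rewrite (exponent_isog isoG).
  by apply/exponentP=> -[[[|[|//]] ?] [[|[|//]] ?]] _; apply/eqP.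
exact: (exponentP exp2).
Qed.

End AbelianClassification.

Theorem theorem1p2 (K : splittingFieldType rat) (iota : {rmorphism K -> algC})
    (abK : abelian_number_field K)
    (F : {subfield K}) (maxF : maximal_totally_real F) :
  ((forall x : K, preperiodic (iota x)) <->
     isog_C1_C2_C3_C2xC2 'Gal(F / 1%AS)%g)
  /\ (~ isog_C1_C2_C3_C2xC2 'Gal(F / 1%AS)%g ->
        exists u : K, algebraic_unit iota u /\ wandering (iota u)).
Proof.
(* Serves as the last clause and, by contraposition, as the only-if direction. *)
have wander : ~ isog_C1_C2_C3_C2xC2 'Gal(F / 1%AS)%g ->
    exists u : K, algebraic_unit iota u /\ wandering (iota u).
  move=> not_small; suff [u [_ Uu] Wu] : exists2 u, unitF iota F u & wandering (iota u).
    by exists u.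
  have [// | ] := abelian_classification (abelian_Gal_subfield abK F).
  case=> [[t [B [defG t3]]] | [s [t [Bs [Bt [defs deft os ot [Bst Bts]]]]]] |].
  - exact: (cyclic_wandering iota abK maxF defG t3).
  - exact: (three_three_wandering iota abK maxF defs deft os ot Bst Bts).
  case=> s [t [r [Bs [Bt [Br [[ds dt dr] [os ot or] [[st sr] [ts tr] [rs rt]]]]]]]].
  exact: (two_two_two_wandering iota abK maxF ds dt dr os ot or st sr ts tr rs rt).
split=> //; split=> [prep | small x]; last first.
  apply: (preperiodic_small_group iota abK maxF).
  have cardG : #|'Gal(F / 1%AS)%g| = #|{: gal_of F}|.
    by apply: eq_card => g; rewrite gal1F.
  rewrite -cardG; case: (isog_C1_C2_C3_C2xC2_small small) => [|[G4 sq1]]; first by left.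
  by right; split=> // g; apply/sq1/gal1F.
by apply: NNPP => /wander[u [_]]; apply.
Qed.
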